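(* Let $k$ be an algebraically closed field of characteristic $p>0$, let $(\mathfrak{g},[p])$ be a finite-dimensional restricted Lie algebra over $k$ such that $V(\mathfrak{g})=\{x\in\mathfrak{g} : x^{[p]}=0\}$ is a subspace of $\mathfrak{g}$, and let $\mathfrak{h}\subseteq\mathfrak{g}$ be a $p$-subalgebra such that $\dim V(\mathfrak{h})\ge 2$. Let $j\in\{1,\ldots,p-1\}$. If $M$ is a finite-dimensional $U_0(\mathfrak{g})$-module of constant $j$-rank, then \[ \deg^j(M)=\deg^j(M|_{\mathfrak{h}}).\]
   Context: $U_0(\mathfrak{g})=U(\mathfrak{g})/(\{x^p-x^{[p]} : x\in\mathfrak{g}\})$ is the restricted enveloping algebra; a $p$-subalgebra is a subalgebra closed under the $p$-map; $M|_{\mathfrak{h}}$ is the restriction of $M$ to $U_0(\mathfrak{h})$, and $V(\mathfrak{h})=V(\mathfrak{g})\cap\mathfrak{h}$. For $x\in\mathfrak{g}$, $x_M:M\to M$ is the operator $m\mapsto x.m$. The generic $j$-rank is $\mathrm{rk}^j(M)=\max\{\mathrm{rk}(x_M^j) : x\in V(\mathfrak{g})\}$, and $M$ has constant $j$-rank if $\mathrm{rk}(x_M^j)=\mathrm{rk}(y_M^j)$ for all $x,y\in V(\mathfrak{g})\setminus\{0\}$. Degree of a morphism: if $U\subseteq\mathbb{P}^n$ is non-empty open and $\varphi:U\to\mathbb{P}^m$ is a morphism, there are homogeneous polynomials $f_0,\ldots,f_m\in k[X_0,\ldots,X_n]$ of the same degree $d$ with $\gcd(f_0,\ldots,f_m)=1$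 and $\varphi(x)=(f_0(x):\cdots:f_m(x))$ for all $x\in U$; they are unique up to a common non-zero scalar, and $\deg(\varphi):=d$. Degree of a module (for a restricted Lie algebra $\mathfrak{g}$ with $V(\mathfrak{g})$ a subspace): let $d_j=\mathrm{rk}^j(M)$. The set $U_{M,j}=\{[x]\in\mathbb{P}(V(\mathfrak{g})) : \mathrm{rk}(x_M^j)=d_j\}$ is open, and $\mathrm{im}^j_M:U_{M,j}\to\mathrm{Gr}_{d_j}(M)$, $[x]\mapsto\mathrm{im}\,x_M^j$, is a morphism to the Grassmannian of $d_j$-dimensional subspaces of $M$. Let $\mathrm{pl}_M:\mathrm{Gr}_{d_j}(M)\to\mathbb{P}(\bigwedge^{d_j}M)$ be the Plücker embedding. The $j$-degree is $\deg^j(M):=\deg(\mathrm{pl}_M\circ\mathrm{im}^j_M)$ if $d_j>0$, and $\deg^j(M):=0$ if $d_j=0$. *)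

(* Defs.v *)
From HB Require Import structures.
From mathcomp Require Import all_boot all_order all_algebra.
From mathcomp Require Import mpoly.
From mathcomp Require Import boolp classical_sets.

Set Implicit Arguments.
Unset Strict Implicit.
Unset Printing Implicit Defensive.

Import GRing.Theory.
Local Open Scope ring_scope.
Local Open Scope quotient_scope.

(* [jacobson_coef br x y n i] is the coefficient of 'X^i in                   *)
(*   (ad (x 'X + y))^n (x),  computed in  L (x) k['X],  with  ad = br.        *)
Fixpoint jacobson_coef (L : zmodType) (br : L -> L -> L) (x y : L)
    (n i : nat) : L :=
  if n is m.+1 then
    (if i is i'.+1 then br x (jacobson_coef br x y m i') else 0)
      + br y (jacobson_coef br x y m i)
  else if i is 0%N then x else 0.

(* Jacobson's polynomials:  i s_i(x, y)  is the coefficient of 'X^(i - 1) in  *)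
(* (ad (x 'X + y))^(p - 1) (x),  for 1 <= i <= p - 1.                         *)
Definition jacobson_s (k : fieldType) (p : nat) (L : lmodType k)
    (br : L -> L -> L) (i : nat) (x y : L) : L :=
  (i%:R : k)^-1 *: jacobson_coef br x y p.-1 i.-1.

(* The prime p is meant to be the characteristic of k.                        *)
HB.mixin Record isRestrictedLie (k : fieldType) (p : nat) L
    of Vector k L := {
  lie_br : L -> L -> L;
  pmap : L -> L;
  lie_brDl : forall a x y z,
    lie_br (a *: x + y) z = a *: lie_br x z + lie_br y z;
  lie_brDr : forall a x y z,
    lie_br z (a *: x + y) = a *: lie_br z x + lie_br z y;
  lie_brxx : forall x, lie_br x x = 0;
  lie_jacobi : forall x y z,
    lie_br x (lie_br y z) + lie_br y (lie_br z x) + lie_br z (lie_br x y) = 0;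
  pmap_ad : forall x y, lie_br (pmap x) y = iter p (lie_br x) y;
  pmapZ : forall (a : k) x, pmap (a *: x) = a ^+ p *: pmap x;
  pmapD : forall x y, pmap (x + y) =
    pmap x + pmap y + \sum_(1 <= i < p) jacobson_s p lie_br i x y }.

#[short(type="rLieType")]
HB.structure Definition RestrictedLie (k : fieldType) (p : nat) :=
  {L of Vector k L & isRestrictedLie k p L}.

Section Subalgebras.
Variables (k : fieldType) (p : nat) (g : rLieType k p).

Record psubalg := PSubalg {
  psubalg_space :> {vspace g};
  psubalg_br : forall x y, x \in psubalg_space -> y \in psubalg_space ->
    lie_br x y \in psubalg_space;
  psubalg_pmap : forall x, x \in psubalg_space -> pmap x \in psubalg_space }.

Definition psub_of (h : psubalg) := subvs_of h.

Variable h : psubalg.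
HB.instance Definition _ := Vector.on (psub_of h).

Definition psub_val (x : psub_of h) : g := vsval x.

Fact psub_br_subproof (x y : psub_of h) :
  lie_br (psub_val x) (psub_val y) \in (h : {vspace g}).
Proof. by apply: psubalg_br; apply: subvsP. Qed.
Fact psub_pmap_subproof (x : psub_of h) :
  pmap (psub_val x) \in (h : {vspace g}).
Proof. by apply: psubalg_pmap; apply: subvsP. Qed.

Definition psub_br (x y : psub_of h) : psub_of h :=
  Subvs (psub_br_subproof x y).
Definition psub_pmap (x : psub_of h) : psub_of h :=
  Subvs (psub_pmap_subproof x).

Lemma psub_val_inj : injective psub_val.
Proof. exact: val_inj. Qed.
Lemma psub_valP : linear psub_val.
Proof. exact: linearP. Qed.
HB.instance Definition _ := GRing.isLinear.Build k (psub_of h) g _ psub_val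
  psub_valP.

Lemma psub_val_br x y :
  psub_val (psub_br x y) = lie_br (psub_val x) (psub_val y).
Proof. by []. Qed.
Lemma psub_val_pmap x : psub_val (psub_pmap x) = pmap (psub_val x).
Proof. by []. Qed.

Lemma psub_val_jacobson_coef x y n i :
  psub_val (jacobson_coef psub_br x y n i)
    = jacobson_coef lie_br (psub_val x) (psub_val y) n i.
Proof.
by elim: n i => [|n IH] [|i] //=; rewrite !IH.
Qed.

Fact psub_brDl a x y z :
  psub_br (a *: x + y) z = a *: psub_br x z + psub_br y z.
Proof. by apply: psub_val_inj; rewrite linearP !psub_val_br linearP lie_brDl. Qed.
Fact psub_brDr a x y z :
  psub_br z (a *: x + y) = a *: psub_br z x + psub_br z y.
Proof. by apply: psub_val_inj; rewrite linearP !psub_val_br linearP lie_brDr. Qed.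
Fact psub_brxx x : psub_br x x = 0.
Proof. by apply: psub_val_inj; rewrite psub_val_br lie_brxx linear0. Qed.
Fact psub_jacobi x y z :
  psub_br x (psub_br y z) + psub_br y (psub_br z x) + psub_br z (psub_br x y)
    = 0.
Proof. by apply: psub_val_inj; apply: lie_jacobi. Qed.
Fact psub_pmap_ad x y : psub_br (psub_pmap x) y = iter p (psub_br x) y.
Proof.
apply: psub_val_inj; rewrite psub_val_br psub_val_pmap pmap_ad.
suff H n : iter n (lie_br (psub_val x)) (psub_val y) =
  psub_val (iter n (psub_br x) y) by apply: H.
by elim: n => //= n ->.
Qed.
Fact psub_pmapZ (a : k) x : psub_pmap (a *: x) = a ^+ p *: psub_pmap x.
Proof. by apply: psub_val_inj; rewrite linearZ !psub_val_pmap linearZ pmapZ. Qed.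
Fact psub_pmapD x y : psub_pmap (x + y) =
  psub_pmap x + psub_pmap y + \sum_(1 <= i < p) jacobson_s p psub_br i x y.
Proof.
apply: psub_val_inj; rewrite psub_val_pmap !linearD pmapD linear_sum /=.
by congr (_ + _); apply: eq_bigr => i _;
   rewrite /jacobson_s -psub_val_jacobson_coef -linearZ.
Qed.

HB.instance Definition _ := isRestrictedLie.Build k p (psub_of h)
  psub_brDl psub_brDr psub_brxx psub_jacobi psub_pmap_ad psub_pmapZ psub_pmapD.

End Subalgebras.

(* U_0(g) is built as the associative unital k-algebra presented by the       *)
(* generators [UGen x], x in g, subject to the k-linearity of UGen, to the    *)
(* relations  xy - yx = [x, y]  of U(g)  and to  x^p = x^[p];  the product x^p *)
(* is written  x (x (... x))  with p factors, p > 0.                          *)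
Inductive uterm (k g : Type) : Type :=
| UGen of g
| UCst of k
| UAdd of uterm k g & uterm k g
| UMul of uterm k g & uterm k g.
Arguments UGen {k g}.
Arguments UCst {k g}.

HB.instance Definition _ (k g : Type) := gen_eqMixin (uterm k g).
HB.instance Definition _ (k g : Type) := gen_choiceMixin (uterm k g).

Section EnvelopingAlgebra.
Variables (k : fieldType) (p : nat) (g : rLieType k p).
Local Notation term := (uterm k g).

Inductive ueq : term -> term -> Prop :=
| ueq_refl t : ueq t t
| ueq_sym t u : ueq t u -> ueq u t
| ueq_trans t u v : ueq t u -> ueq u v -> ueq t v
| ueq_add t t' u u' : ueq t t' -> ueq u u' -> ueq (UAdd t u) (UAdd t' u')
| ueq_mul t t' u u' : ueq t t' -> ueq u u' -> ueq (UMul t u) (UMul t' u')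
| ueq_addA t u v : ueq (UAdd t (UAdd u v)) (UAdd (UAdd t u) v)
| ueq_addC t u : ueq (UAdd t u) (UAdd u t)
| ueq_add0 t : ueq (UAdd (UCst 0) t) t
| ueq_addN t : ueq (UAdd (UMul (UCst (-1)) t) t) (UCst 0)
| ueq_mulA t u v : ueq (UMul t (UMul u v)) (UMul (UMul t u) v)
| ueq_mul1l t : ueq (UMul (UCst 1) t) t
| ueq_mul1r t : ueq (UMul t (UCst 1)) t
| ueq_mulDl t u v : ueq (UMul (UAdd t u) v) (UAdd (UMul t v) (UMul u v))
| ueq_mulDr t u v : ueq (UMul t (UAdd u v)) (UAdd (UMul t u) (UMul t v))
| ueq_cstD a b : ueq (UCst (a + b)) (UAdd (UCst a) (UCst b))
| ueq_cstM a b : ueq (UCst (a * b)) (UMul (UCst a) (UCst b))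
| ueq_cstC a t : ueq (UMul (UCst a) t) (UMul t (UCst a))
| ueq_lin a x y :
    ueq (UGen (a *: x + y)) (UAdd (UMul (UCst a) (UGen x)) (UGen y))
| ueq_lie x y :
    ueq (UAdd (UMul (UGen x) (UGen y))
              (UMul (UCst (-1)) (UMul (UGen y) (UGen x))))
        (UGen (lie_br x y))
| ueq_pmap x : ueq (iter p.-1 (UMul (UGen x)) (UGen x)) (UGen (pmap x)).

Definition ueqb (t u : term) : bool := `[< ueq t u >].

Fact ueqb_equiv : equiv_class_of ueqb.
Proof.
split=> [t|t u|u t v]; rewrite /ueqb.
- by apply/asboolP; apply: ueq_refl.
- by apply/idP/idP=> /asboolP h; apply/asboolP; apply: ueq_sym.
- by move=> /asboolP h1 /asboolP h2; apply/asboolP; apply: ueq_trans h1 h2.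
Qed.
Canonical ueqb_equivRel := EquivRelPack ueqb_equiv.

Definition U0 := {eq_quot ueqb}.
HB.instance Definition _ := Choice.on U0.
HB.instance Definition _ := EqQuotient.on U0.

Lemma U0_eqP (t u : term) : reflect (ueq t u) (\pi_U0 t == \pi_U0 u).
Proof. by rewrite eqmodE; apply: asboolP. Qed.
Lemma U0_eq (t u : term) : ueq t u -> \pi_U0 t = \pi_U0 u.
Proof. by move=> /U0_eqP/eqP. Qed.
Lemma U0_repr (t : term) : ueq (repr (\pi_U0 t)) t.
Proof. by apply/U0_eqP; rewrite reprK. Qed.

Definition U0_cst (a : k) : U0 := \pi_U0 (UCst a).
Definition U0_add (a b : U0) : U0 := \pi_U0 (UAdd (repr a) (repr b)).
Definition U0_mul (a b : U0) : U0 := \pi_U0 (UMul (repr a) (repr b)).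
Definition U0_opp (a : U0) : U0 := U0_mul (U0_cst (-1)) a.
Definition U0_scale (c : k) (a : U0) : U0 := U0_mul (U0_cst c) a.

Definition U0_gen (x : g) : U0 := \pi_U0 (UGen x).

Lemma U0_addE t u : U0_add (\pi_U0 t) (\pi_U0 u) = \pi_U0 (UAdd t u).
Proof. by apply: U0_eq; apply: ueq_add; apply: U0_repr. Qed.
Lemma U0_mulE t u : U0_mul (\pi_U0 t) (\pi_U0 u) = \pi_U0 (UMul t u).
Proof. by apply: U0_eq; apply: ueq_mul; apply: U0_repr. Qed.

Fact U0_addA : associative U0_add.
Proof.
by elim/quotW=> t; elim/quotW=> u; elim/quotW=> v;
   rewrite (U0_addE u v) (U0_addE t u) !U0_addE;
   apply: U0_eq; apply: ueq_addA.
Qed.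
Fact U0_addC : commutative U0_add.
Proof.
by elim/quotW=> t; elim/quotW=> u; rewrite !U0_addE; apply: U0_eq;
   apply: ueq_addC.
Qed.
Fact U0_add0 : left_id (U0_cst 0) U0_add.
Proof. by elim/quotW=> t; rewrite !U0_addE; apply: U0_eq; apply: ueq_add0. Qed.
Fact U0_addN : left_inverse (U0_cst 0) U0_opp U0_add.
Proof.
by elim/quotW=> t; rewrite /U0_opp U0_mulE U0_addE; apply: U0_eq;
   apply: ueq_addN.
Qed.
HB.instance Definition _ :=
  GRing.isZmodule.Build U0 U0_addA U0_addC U0_add0 U0_addN.

Fact U0_mulA : associative U0_mul.
Proof.
by elim/quotW=> t; elim/quotW=> u; elim/quotW=> v;
   rewrite (U0_mulE u v) (U0_mulE t u) !U0_mulE;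
   apply: U0_eq; apply: ueq_mulA.
Qed.
Fact U0_mul1l : left_id (U0_cst 1) U0_mul.
Proof. by elim/quotW=> t; rewrite !U0_mulE; apply: U0_eq; apply: ueq_mul1l. Qed.
Fact U0_mul1r : right_id (U0_cst 1) U0_mul.
Proof. by elim/quotW=> t; rewrite !U0_mulE; apply: U0_eq; apply: ueq_mul1r. Qed.
Fact U0_mulDl : left_distributive U0_mul U0_add.
Proof.
by elim/quotW=> t; elim/quotW=> u; elim/quotW=> v;
   rewrite (U0_addE t u) (U0_mulE t v) (U0_mulE u v) U0_mulE U0_addE;
   apply: U0_eq; apply: ueq_mulDl.
Qed.
Fact U0_mulDr : right_distributive U0_mul U0_add.
Proof.
by elim/quotW=> t; elim/quotW=> u; elim/quotW=> v;
   rewrite (U0_addE u v) (U0_mulE t u) (U0_mulE t v) U0_mulE U0_addE;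
   apply: U0_eq; apply: ueq_mulDr.
Qed.

Fixpoint uaugment (t : term) : k :=
  match t with
  | UGen _ => 0
  | UCst a => a
  | UAdd t u => uaugment t + uaugment u
  | UMul t u => uaugment t * uaugment u
  end.

Lemma uaugment_ueq t u : ueq t u -> uaugment t = uaugment u.
Proof.
elim=> //=; try by move=> *; congruence.
- by move=> *; rewrite addrA.
- by move=> *; rewrite addrC.
- by move=> *; rewrite add0r.
- by move=> *; rewrite mulN1r addNr.
- by move=> *; rewrite mulrA.
- by move=> *; rewrite mul1r.
- by move=> *; rewrite mulr1.
- by move=> *; rewrite mulrDl.
- by move=> *; rewrite mulrDr.
- by move=> *; rewrite mulrC.
- by move=> *; rewrite mulr0 addr0.
- by move=> *; rewrite !mulr0 addr0.
- by move=> x; case: p.-1 => //= n; rewrite mul0r.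
Qed.

Fact U0_oner_neq0 : U0_cst 1 != 0 :> U0.
Proof.
apply/negP => /U0_eqP/uaugment_ueq /= /eqP; apply/negP; exact: oner_neq0.
Qed.

HB.instance Definition _ := GRing.Zmodule_isNzRing.Build U0
  U0_mulA U0_mul1l U0_mul1r U0_mulDl U0_mulDr U0_oner_neq0.

Lemma U0_cstD a b : U0_cst (a + b) = U0_cst a + U0_cst b.
Proof. by rewrite /GRing.add /= U0_addE; apply: U0_eq; apply: ueq_cstD. Qed.
Lemma U0_cstM a b : U0_cst (a * b) = U0_cst a * U0_cst b.
Proof. by rewrite {2}/GRing.mul /= U0_mulE; apply: U0_eq; apply: ueq_cstM. Qed.
Lemma U0_cstC a (u : U0) : U0_cst a * u = u * U0_cst a.
Proof.
by move: u; elim/quotW=> t; rewrite /GRing.mul /= !U0_mulE; apply: U0_eq;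
   apply: ueq_cstC.
Qed.

Fact U0_scaleA a b (u : U0) : U0_scale a (U0_scale b u) = U0_scale (a * b) u.
Proof. by rewrite /U0_scale U0_cstM U0_mulA. Qed.
Fact U0_scale1 : left_id 1 U0_scale.
Proof. exact: U0_mul1l. Qed.
Fact U0_scaleDr : right_distributive U0_scale +%R.
Proof. by move=> a u v; apply: U0_mulDr. Qed.
Fact U0_scaleDl (u : U0) : {morph U0_scale^~ u : a b / a + b}.
Proof. by move=> a b; rewrite /U0_scale U0_cstD; apply: U0_mulDl. Qed.
HB.instance Definition _ := GRing.Zmodule_isLmodule.Build k U0
  U0_scaleA U0_scale1 U0_scaleDr U0_scaleDl.

Fact U0_scaleAl (a : k) (u v : U0) : a *: (u * v) = a *: u * v.
Proof. exact: U0_mulA. Qed.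
HB.instance Definition _ := GRing.Lmodule_isLalgebra.Build k U0 U0_scaleAl.
Fact U0_scaleAr (a : k) (u v : U0) : a *: (u * v) = u * (a *: v).
Proof.
change (U0_cst a * (u * v) = u * (U0_cst a * v)).
by rewrite mulrA U0_cstC mulrA.
Qed.
HB.instance Definition _ := GRing.Lalgebra_isAlgebra.Build k U0 U0_scaleAr.

Lemma U0_gen_linear : linear U0_gen.
Proof.
by move=> a x y; rewrite /U0_gen (U0_eq (ueq_lin a x y)) -U0_addE -U0_mulE.
Qed.
HB.instance Definition _ :=
  GRing.isLinear.Build k g U0 _ U0_gen U0_gen_linear.
Lemma U0_gen_br x y :
  U0_gen (lie_br x y) = U0_gen x * U0_gen y - U0_gen y * U0_gen x.
Proof. by rewrite /U0_gen -(U0_eq (ueq_lie x y)) -U0_addE -!U0_mulE. Qed.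
Lemma U0_gen_pmap x : (0 < p)%N -> U0_gen (pmap x) = U0_gen x ^+ p.
Proof.
move=> p_gt0; rewrite /U0_gen -(U0_eq (ueq_pmap x)).
suff H n : \pi_U0 (iter n (UMul (UGen x)) (UGen x)) = U0_gen x ^+ n.+1.
  by rewrite H prednK.
elim: n => [|n IH]; first by rewrite expr1.
by rewrite exprS -IH /= -U0_mulE.
Qed.

End EnvelopingAlgebra.

Section SubEnveloping.
Variables (k : fieldType) (p : nat) (g : rLieType k p) (h : psubalg g).

Fixpoint uterm_incl (t : uterm k (psub_of h)) : uterm k g :=
  match t with
  | UGen x => UGen (psub_val x)
  | UCst a => UCst a
  | UAdd t u => UAdd (uterm_incl t) (uterm_incl u)
  | UMul t u => UMul (uterm_incl t) (uterm_incl u)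
  end.

Lemma uterm_incl_ueq t u : ueq t u -> ueq (uterm_incl t) (uterm_incl u).
Proof.
elim=> /=; try by move=> *; constructor.
- by move=> t1 t2 t3 _ IH1 _ IH2; apply: ueq_trans IH1 IH2.
- move=> x; suff -> : uterm_incl (iter p.-1 (UMul (UGen x)) (UGen x)) =
    iter p.-1 (UMul (UGen (psub_val x))) (UGen (psub_val x)).
    exact: ueq_pmap.
  by move: p.-1 => n; elim: n => //= n ->.
Qed.

Definition U0_incl (u : U0 (psub_of h)) : U0 g := \pi_(U0 g) (uterm_incl (repr u)).

Lemma U0_inclE t : U0_incl (\pi_(U0 (psub_of h)) t) = \pi_(U0 g) (uterm_incl t).
Proof. by apply: U0_eq; apply: uterm_incl_ueq; apply: U0_repr. Qed.

Fact U0_incl_linear : linear U0_incl.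
Proof.
move=> a; elim/quotW=> t; elim/quotW=> u.
have -> : a *: (\pi t : U0 (psub_of h)) + (\pi u : U0 (psub_of h)) =
    \pi_(U0 (psub_of h)) (UAdd (UMul (UCst a) t) u).
  by rewrite -U0_addE -U0_mulE.
by rewrite !U0_inclE /= -U0_addE -U0_mulE.
Qed.
HB.instance Definition _ := GRing.isLinear.Build k (U0 (psub_of h)) (U0 g) _
  U0_incl U0_incl_linear.
Fact U0_incl_monoid_morphism : monoid_morphism U0_incl.
Proof.
split; first exact: U0_inclE.
elim/quotW=> t; elim/quotW=> u.
have -> : (\pi t : U0 (psub_of h)) * (\pi u : U0 (psub_of h)) =
    \pi_(U0 (psub_of h)) (UMul t u).
  by rewrite -U0_mulE.
by rewrite !U0_inclE /= -U0_mulE.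
Qed.
HB.instance Definition _ := GRing.isMonoidMorphism.Build (U0 (psub_of h)) (U0 g)
  U0_incl U0_incl_monoid_morphism.

End SubEnveloping.

Record fdmodule (k : fieldType) (A : algType k) := FdModule {
  fdm_space :> vectType k;
  fdm_act : A -> fdm_space -> fdm_space;
  fdm_actDl : forall m, linear (fdm_act^~ m);
  fdm_actDr : forall a, linear (fdm_act a);
  fdm_act1 : forall m, fdm_act 1 m = m;
  fdm_actM : forall a b m, fdm_act (a * b) m = fdm_act a (fdm_act b m) }.

Section Pullback.
Variables (k : fieldType) (A B : algType k) (f : {lrmorphism B -> A}).
Variable M : fdmodule A.

Definition pullback_act (b : B) (m : M) : M := fdm_act (f b) m.

Fact pullback_actDl m : linear (pullback_act^~ m).
Proof. by move=> c a b; rewrite /pullback_act linearP fdm_actDl. Qed.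
Fact pullback_actDr b : linear (pullback_act b).
Proof. exact: fdm_actDr. Qed.
Fact pullback_act1 m : pullback_act 1 m = m.
Proof. by rewrite /pullback_act rmorph1 fdm_act1. Qed.
Fact pullback_actM a b m :
  pullback_act (a * b) m = pullback_act a (pullback_act b m).
Proof. by rewrite /pullback_act rmorphM fdm_actM. Qed.

Definition pullback : fdmodule B :=
  FdModule pullback_actDl pullback_actDr pullback_act1 pullback_actM.
End Pullback.

Definition restrict (k : fieldType) (p : nat) (g : rLieType k p)
    (h : psubalg g) (M : fdmodule (U0 g)) : fdmodule (U0 (psub_of h)) :=
  pullback (@U0_incl k p g h) M.

Section NullCone.
Variables (k : fieldType) (p : nat) (g : rLieType k p).

Definition nullcone : {pred g} := [pred x | pmap x == 0].

Definition nullcone_is_subspace : Prop :=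
  exists V : {vspace g}, V =i nullcone.

(* V(g) as a subspace of g; meaningful only under [nullcone_is_subspace].     *)
Definition nullspace : {vspace g} := xget 0%VS [set V | V =i nullcone].
End NullCone.
Arguments nullcone {k p} g.

Section Rank.
Variables (k : fieldType) (p : nat) (g : rLieType k p) (M : fdmodule (U0 g)).

Definition operator (x : g) : 'End(M) := linfun (fdm_act (U0_gen x)).

Definition operator_pow (j : nat) (x : g) : 'End(M) :=
  iter j (comp_lfun (operator x)) \1%VF.

Definition op_rank (j : nat) (x : g) : nat := \dim (limg (operator_pow j x)).

(* The ranks are bounded by dim M, so that the maximum is taken over a finite *)
(* range.                                                                     *)
Definition generic_jrank (j : nat) : nat :=
  \max_(r < (\dim {:M}).+1 |
    `[< exists2 x : g, x \in nullcone g & op_rank j x = r >]) r.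

Definition constant_jrank (j : nat) : Prop :=
  forall x y : g, x \in nullcone g -> x != 0 -> y \in nullcone g -> y != 0 ->
    op_rank j x = op_rank j y.
End Rank.

Section MorphismDegree.
Variables (k : fieldType) (E F : vectType k).

Definition hcoord (x : E) : 'I_(\dim {:E}) -> k :=
  fun i => coord (vbasis {:E}) i x.

Definition gcd_is_one (n m : nat) (f : 'I_m -> {mpoly k[n]}) : Prop :=
  forall c : {mpoly k[n]}, (forall i, exists q, f i = q * c) ->
    c \is a GRing.unit.

(* A map from U, a subset of P(E), to P(F) is given as a function of a        *)
(* non-zero representative x of the point [x]; points of P(F) are             *)
(* one-dimensional subspaces of F. The homogeneous coordinates on P(E) and    *)
(* P(F) are those of the bases [vbasis fullv] of E and F.                     *)
Definition is_morphism_degree (U : E -> bool) (phi : E -> {vspace F})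
    (d : nat) : Prop :=
  exists f : 'I_(\dim {:F}) -> {mpoly k[\dim {:E}]},
    [/\ forall i, f i \is d.-homog,
        gcd_is_one f &
        forall x : E, x != 0 -> U x ->
          phi x = <[\sum_i (f i).@[hcoord x] *: (vbasis {:F})`_i]>%VS].

Definition morphism_degree (U : E -> bool) (phi : E -> {vspace F}) : nat :=
  xget 0%N [set d | is_morphism_degree U phi d].
End MorphismDegree.

Section Plucker.
Variables (k : fieldType) (M : vectType k) (d : nat).

Definition incr_idx := {s : {ffun 'I_d -> 'I_(\dim {:M})} |
  [forall i : 'I_d, forall j : 'I_d, (i < j)%N ==> (s i < s j)%N]}.

(* The d-th exterior power of M, in the basis                                 *)
(*   e_(s 0) /\ ... /\ e_(s (d - 1)),  s : 'I_d -> 'I_(dim M) increasing,     *)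
(* for e the basis [vbasis fullv] of M.                                       *)
Definition extpow := {ffun incr_idx -> k^o}.

(* w_0 /\ ... /\ w_(d - 1): its coordinates are the maximal minors.           *)
Definition wedge (w : seq M) : extpow :=
  [ffun s : incr_idx =>
    \det (\matrix_(i < d, j < d) coord (vbasis {:M}) (val s j) w`_i)].

(* To be used for subspaces W of dimension d only.                            *)
Definition plucker (W : {vspace M}) : {vspace extpow} :=
  <[wedge (vbasis W)]>%VS.
End Plucker.

Definition jdegree (k : fieldType) (p : nat) (g : rLieType k p)
    (j : nat) (M : fdmodule (U0 g)) : nat :=
  let d := generic_jrank M j in
  if d == 0%N then 0%N
  else morphism_degree
    (fun x : subvs_of (nullspace g) => op_rank M j (vsval x) == d)
    (fun x => plucker d (limg (operator_pow M j (vsval x)))).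

(* Main.v *)
Require Import Defs.
From HB Require Import structures.
From mathcomp Require Import all_boot all_order all_algebra.
From mathcomp Require Import perm mpoly.
From mathcomp Require Import boolp classical_sets.

(* Write x_M^j as a matrix of homogeneous polynomials in the coordinates of x *)
(* in V(g). At each x <> 0 its vectors of maximal minors, one for every       *)
(* choice of rows, are multiples of the Pluecker vector of im x_M^j, and one  *)
(* of them is non-zero. As k[X_1, .., X_n] is factorial, dividing one such    *)
(* vector of minors by its gcd gives a primitive vector f of which all the    *)
(* others are polynomial multiples. So f has no zero outside 0, represents    *)
(* the Pluecker map everywhere, and computes deg^j(M).                        *)
(* The restriction of f to V(h) still has no zero outside 0. A non-constant   *)
(* polynomial in at least two variables over an algebraically closed field    *)
(* does have such a zero, so the restricted components have gcd 1, and the    *)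
(* degree of f also computes the degree of the restriction of M.              *)

Set Implicit Arguments.
Unset Strict Implicit.
Unset Printing Implicit Defensive.

Import GRing.Theory passmx.
Local Open Scope ring_scope.

(** * Factorial rings *)

(** Constant [j]-rank makes the Pluecker map of $M$ a morphism on all of
    $\mathbb{P}(V(\mathfrak{g}))$, and the map of $M|_{\mathfrak{h}}$ is its composite with the
    linear inclusion of $\mathbb{P}(V(\mathfrak{h}))$. The degree could drop only if the restricted
    components acquired a common factor. By [nonvanishing_unit] such a factor has a zero outside 0,
    hence would force the map to vanish at a point of $V(\mathfrak{h})$; this is
    [is_morphism_degree_restrict]. What must be constructed is a representation with gcd 1 that is
    valid at every point. [minors_wedge] makes every vector of minors a multiple of the Pluecker
    vector, and factoriality ([factorial_mpoly], through [gcd_is_one_dvdr]) turns this into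
    [is_morphism_degree_exists]. [is_morphism_degree_uniq] then identifies the chosen degree. *)

Section Factorial.
Variable R : idomainType.
Implicit Types a b q u : R.

Definition dvdr a b := exists c, b = c * a.

Definition prime_elt q :=
  [/\ q != 0, q \isn't a GRing.unit &
      forall a b, dvdr q (a * b) -> dvdr q a \/ dvdr q b].

(** The class [C] is a parameter so that constants of a polynomial ring can be factored into
    constant primes only. With [C] the primes, existence of factorisations already characterises
    factorial domains. *)
Inductive factored (C : R -> Prop) : R -> Prop :=
| factored_unit u : u \is a GRing.unit -> factored C u
| factored_mul q a : C q -> factored C a -> factored C (q * a).

Definition factorial_ring := forall a, a != 0 -> factored prime_elt a.

Lemma unitr_neq0 u : u \is a GRing.unit -> u != 0.
Proof. by apply: contraTneq => ->; rewrite unitr0. Qed.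

Lemma dvdr_mull a b c : dvdr a b -> dvdr a (c * b).
Proof. by case=> d ->; exists (c * d); rewrite mulrA. Qed.

Lemma dvdr_mulr a b c : dvdr a b -> dvdr a (b * c).
Proof. by rewrite mulrC; apply: dvdr_mull. Qed.

Lemma dvdr_add a b c : dvdr a b -> dvdr a c -> dvdr a (b + c).
Proof. by case=> d -> [e ->]; exists (d + e); rewrite mulrDl. Qed.

Lemma dvdr_sub a b c : dvdr a (b + c) -> dvdr a b -> dvdr a c.
Proof.
by case=> d e [f ef]; exists (d - f); rewrite mulrBl -e -ef addrAC subrr add0r.
Qed.

Lemma factoredM C a b : factored C a -> factored C b -> factored C (a * b).
Proof.
move=> fa fb; elim: fa => [u Uu|q c Cq _ IH]; last first.
  by rewrite -mulrA; apply: factored_mul.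
elim: fb => [v Uv|q c Cq _ IH]; first by apply: factored_unit; rewrite unitrM Uu.
by rewrite mulrCA; apply: factored_mul.
Qed.

Lemma factoredW (C D : R -> Prop) a :
  (forall q, C q -> D q) -> factored C a -> factored D a.
Proof.
move=> CD; elim=> [u|q b Cq _]; first exact: factored_unit.
by apply: factored_mul; apply: CD.
Qed.

(* Strip the prime factors of [a] one by one: each of them divides [f t * b]  *)
(* for all t, hence divides b, since it does not divide every [f t].          *)
Lemma factored_dvdr C a T (f Y : T -> R) b :
  (forall q, C q -> prime_elt q) -> factored C a ->
  (forall q, C q -> ~ forall t, dvdr q (f t)) ->
  (forall t, a * Y t = f t * b) -> dvdr a b.
Proof.
move=> Cp fa Cf; elim: fa b => [u Uu|q c Cq _ IH] b e.
  by exists (b / u); rewrite divrK.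
have [q0 _ qp] := Cp q Cq.
have [[b' eb]|nb] := pselect (dvdr q b); last first.
  case: (Cf q Cq) => t; have: dvdr q (f t * b).
    by exists (c * Y t); rewrite -e [RHS]mulrC mulrA.
  by case/qp.
have [t|d ed] := IH b'; last by exists d; rewrite eb ed -mulrA [c * q]mulrC.
by apply: (mulfI q0); rewrite mulrA e eb [RHS]mulrC mulrA.
Qed.

End Factorial.

(** * Gauss's lemma: polynomials over a factorial ring *)

Section FactorialPoly.
Variable R : idomainType.
Hypothesis factR : factorial_ring R.
Implicit Types (P D Q f g h : {poly R}) (q : R).

Definition const_prime P := exists2 q, prime_elt q & P = q%:P.

Lemma dvdr_polyC_mulX q P : q != 0 -> dvdr q%:P (P * 'X) -> dvdr q%:P P.
Proof.
move=> q0 [w]; elim/poly_ind: w => [|w c _] e.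
  by exists 0; apply: (mulIf (negbT (polyX_eq0 R))); rewrite e !mul0r.
have c0 : c = 0.
  move/(congr1 (fun P => P`_0)): e.
  rewrite coefMX eqxx mulrDl coefD mulrAC coefMX eqxx add0r -polyCM coefC eqxx.
  by move/esym/eqP; rewrite mulf_eq0 (negPf q0) orbF => /eqP.
exists w; apply: (mulIf (negbT (polyX_eq0 R))).
by rewrite e c0 addr0 mulrAC.
Qed.

Lemma dvdr_polyC q a : dvdr q a -> dvdr q%:P a%:P.
Proof. by case=> c ->; exists c%:P; rewrite polyCM. Qed.

(** Induction on both factors: [q] divides the product of the constant terms, hence one of them.
    Subtracting that term and cancelling ['X] leaves a product with a shorter factor. *)
Lemma prime_elt_polyC q : prime_elt q -> prime_elt q%:P.
Proof.
case=> q0 nuq qp; split=> [|| a].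
- by rewrite polyC_eq0.
- by rewrite poly_unitE coefC eqxx (negPf nuq) andbF.
elim/poly_ind: a => [|a c IHa] b; first by left; exists 0; rewrite mul0r.
elim/poly_ind: b => [|b d IHb]; first by right; exists 0; rewrite mul0r.
move=> dv; have : dvdr q (c * d).
  case: dv => w /(congr1 (fun P => P`_0)) e; exists w`_0.
  move: e; rewrite coef0M !coefD !coefMX !coefC !eqxx !add0r => ->.
  by rewrite coefMC.
case/qp=> [/dvdr_polyC dc|/dvdr_polyC dd].
  have {}dv : dvdr q%:P (a * (b * 'X + d%:P)).
    apply: dvdr_polyC_mulX => //; rewrite mulrAC.
    apply: (@dvdr_sub _ _ (c%:P * (b * 'X + d%:P))); last exact: dvdr_mulr.
    by rewrite -mulrDl [c%:P + _]addrC.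
  case: (IHa _ dv) => [da|]; last by right.
  by left; apply: dvdr_add => //; apply: dvdr_mulr.
have {}dv : dvdr q%:P ((a * 'X + c%:P) * b).
  apply: dvdr_polyC_mulX => //; rewrite -mulrA.
  apply: (@dvdr_sub _ _ ((a * 'X + c%:P) * d%:P)); last exact: dvdr_mull.
  by rewrite -mulrDr [d%:P + _]addrC.
case: (IHb dv) => [|db]; first by left.
by right; apply: dvdr_add => //; apply: dvdr_mulr.
Qed.

Lemma const_prime_elt P : const_prime P -> prime_elt P.
Proof. by case=> q qp ->; apply: prime_elt_polyC. Qed.

Lemma factored_polyC a : a != 0 -> factored const_prime a%:P.
Proof.
move/factR; elim=> [u Uu|q b qp _ IH].
  by apply: factored_unit; rewrite poly_unitE size_polyC coefC eqxx Uu unitr_neq0.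
by rewrite polyCM; apply: factored_mul => //; exists q.
Qed.

(** A factorisation over the fraction field descends to [R]: each prime factor of the denominator
    [a] divides [D] or [Q] and is cancelled there, which keeps the sizes. *)
Lemma factored_split a P D Q : a != 0 -> a%:P * P = D * Q ->
  exists D' Q', [/\ P = D' * Q', size D' = size D & size Q' = size Q].
Proof.
move/factR=> fa; elim: fa D Q => [u Uu|q b qp _ IH] D Q e.
  exists (u^-1%:P * D), Q; split=> //.
    by rewrite -mulrA -e mulrA -polyCM mulVr // mul1r.
  by rewrite mul_polyC size_scale // invr_eq0 unitr_neq0.
have q0 : q%:P != 0 by case: (prime_elt_polyC qp).
have sz (D1 : {poly R}) : size (D1 * q%:P) = size D1.
  by rewrite mulrC mul_polyC size_scale // -polyC_eq0.
have : dvdr q%:P (D * Q).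
  by exists (b%:P * P); rewrite -e polyCM [RHS]mulrC mulrA.
have [_ _ qp'] := prime_elt_polyC qp.
case/qp' => [[D1 eD]|[Q1 eQ]].
  rewrite eD sz; apply: IH; apply: (mulfI q0).
  by rewrite mulrA -polyCM e eD mulrA [q%:P * _]mulrC.
rewrite eQ sz; apply: IH; apply: (mulfI q0).
by rewrite mulrA -polyCM e eQ [RHS]mulrC mulrA.
Qed.

Definition primitive P := forall q, prime_elt q -> ~ dvdr q%:P P.

Lemma lead_coef_dvdr q P : dvdr q%:P P -> dvdr q (lead_coef P).
Proof. by case=> c ->; exists (lead_coef c); rewrite lead_coefM lead_coefC. Qed.

(** A constant prime dividing [P] divides its leading coefficient, so only the primes in that
    coefficient need testing. Here [l] holds those still to be tested, and no prime dividing [r]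
    divides [P]. *)
Lemma primitive_part_aux l P r : factored (@prime_elt R) l -> P != 0 ->
  (forall q, prime_elt q -> dvdr q r -> ~ dvdr q%:P P) ->
  lead_coef P = r * l ->
  exists2 c, c != 0 & exists2 P0, P = c%:P * P0 & primitive P0.
Proof.
move=> fl; elim: fl P r => [u Uu|q b qp _ IH] P r P0 hr lP.
  exists 1; rewrite ?oner_eq0 //; exists P; first by rewrite mul1r.
  move=> q qp dqP; apply: (hr q qp) => //.
  have [c ec] := lead_coef_dvdr dqP.
  by exists (c / u); apply: (mulIr Uu); rewrite -lP ec mulrAC divrK.
have [q0 nuq qp'] := qp.
have [[P1 eP]|nqP] := pselect (dvdr q%:P P).
  have P1_0 : P1 != 0 by apply: contraNneq P0 => e; rewrite eP e mul0r.
  have [||c c0 [P2 eP2 prP2]] := IH P1 r P1_0.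
  - move=> t tp /(hr t tp) ntP [w ew]; apply: ntP; exists (w * q%:P).
    by rewrite eP ew mulrAC.
  - by apply: (mulIf q0); move: lP; rewrite eP lead_coefM lead_coefC => ->; rewrite [q * b]mulrC mulrA.
  exists (c * q); first exact: mulf_neq0.
  by exists P2; rewrite // eP eP2 polyCM mulrAC.
apply: (IH P (r * q) P0); last by rewrite lP mulrA.
move=> t tp; have [t0 nut tp'] := tp.
case/tp' => [|[v ev] dtP]; first exact: hr.
(* A prime [t] dividing the prime [q] is associated to it, so [q] would divide [P] as well. *)
have : dvdr q (v * t) by rewrite -ev; exists 1; rewrite mul1r.
case/qp' => [[w ew]|[w ew]].
  case/negP: nut; apply/unitrPr; exists w; apply: (mulfI q0).
  by rewrite mulr1 [RHS]ev ew mulrA [LHS]mulrC mulrA.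
by apply: nqP; case: dtP => y ->; exists (y * w%:P); rewrite ew polyCM mulrA.
Qed.

Lemma primitive_part P : P != 0 ->
  exists2 c, c != 0 & exists2 P0, P = c%:P * P0 & primitive P0.
Proof.
move=> P0; apply: (@primitive_part_aux (lead_coef P) P 1) => //.
- by apply: factR; rewrite lead_coef_eq0.
- move=> q [_ nu _] [c e]; case/negP: nu; apply/unitrPr; exists c.
  by rewrite mulrC -e.
- by rewrite mul1r.
Qed.

Lemma primitive_dvdr P a h : primitive P -> a != 0 ->
  dvdr P (a%:P * h) -> dvdr P h.
Proof.
move=> prP a0 [w e].
have [||c ec] := @factored_dvdr _ _ _ unit (fun _ => P) (fun _ => h) w
  const_prime_elt (factored_polyC a0).
- by move=> _ [q qp ->] /(_ tt); apply: prP.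
- by move=> _; rewrite e mulrC.
exists c; apply: (@mulfI _ a%:P); first by rewrite polyC_eq0.
by rewrite e ec mulrA [a%:P * c]mulrC.
Qed.

(* The last hypothesis says that [P] is irreducible over the fraction field.  *)
Lemma primitive_irreducible_prime P : primitive P -> (1 < size P)%N ->
  (forall a D Q, a != 0 -> a%:P * P = D * Q ->
     ~~ ((size D < size P)%N && (size Q < size P)%N)) ->
  prime_elt P.
Proof.
move=> prP szP irrP.
have P0 : P != 0 by rewrite -size_poly_gt0 (ltn_trans _ szP).
split=> // [|g h dP].
  by rewrite poly_unitE (gtn_eqF szP).
have [cop|ncop] := boolP (coprimep P g).
  (* A Bezout identity over the fraction field, cleared of denominators and multiplied by [h], shows
     that [P] divides a non-zero constant times [h]. *)
  right; have /Pdiv.Idomain.Bezout_coprimepP[[u v] /=] := cop.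
  case/Pdiv.Idomain.eqpP=> -[c1 c2] /= /andP[c10 c20] e.
  apply: (primitive_dvdr prP c20); case: dP => w ew.
  exists (c1%:P * (u * h + v * w)).
  have -> : c2%:P * h = (c2 *: 1) * h by rewrite -mul_polyC mulr1.
  rewrite -e -mul_polyC -!mulrA; congr (_ * _).
  by rewrite !mulrDl; congr (_ + _); [rewrite mulrAC | rewrite -!mulrA ew].
left; set D := gcdp P g.
have D0 : D != 0 by rewrite Pdiv.Idomain.gcdp_eq0 (negPf P0).
have szD : (1 < size D)%N.
  by rewrite ltn_neqAle eq_sym size_poly_gt0 D0 andbT.
have /Pdiv.Idomain.dvdpP[[a Q] /= a0] := Pdiv.Idomain.dvdp_gcdl P g.
rewrite -mul_polyC -/D => eP.
have /Pdiv.Idomain.dvdpP[[b t] /= b0] := Pdiv.Idomain.dvdp_gcdr P g.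
rewrite -mul_polyC -/D => eg.
have aP0 : a%:P * P != 0 by rewrite mulf_neq0 // polyC_eq0.
have Q0 : Q != 0 by apply: contraNneq aP0 => e; rewrite eP e mul0r.
have szE : (size P = (size Q + size D).-1)%N.
  by rewrite -size_mul // -eP mul_polyC size_scale.
(* As [D] is not constant, irreducibility forces the cofactor [Q] to be constant. So [P] and the gcd
   [D] agree up to constants, and [D] divides [g] up to a constant. *)
have := irrP a Q D a0 eP.
have szQ1 : (0 < size Q)%N by rewrite size_poly_gt0.
have -> : (size Q < size P)%N.
  by rewrite szE; case: (size D) szD => [|[|m]] // _; rewrite addnS /= addnS ltnS leq_addr.
rewrite -leqNgt szE => le.
have : size Q == 1%N.
  rewrite eqn_leq szQ1 andbT; move: le szQ1.
  by case: (size Q) => [|m] //=; rewrite -{2}[size D]add0n leq_add2r leqn0 => /eqP->.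
case/size_poly1P=> c c0 eQ.
have cb0 : c * b != 0 by rewrite mulf_neq0.
apply: (primitive_dvdr prP cb0); exists (t * a%:P).
by rewrite -mulrA eP polyCM -mulrA eg eQ mulrCA.
Qed.

(** Induction on the size: the content factors in [R], and the primitive part either splits over the
    fraction field, hence over [R], into smaller factors, or is prime. *)
Lemma factorial_poly : factorial_ring {poly R}.
Proof.
move=> f; have [n] := ubnP (size f); elim: n f => // n IH f szf f0.
have [c c0 [P eP prP]] := primitive_part f0.
rewrite eP; apply: factoredM.
  by apply: factoredW (factored_polyC c0); apply: const_prime_elt.
have szP : size P = size f by rewrite eP mul_polyC size_scale.
have P0 : P != 0 by rewrite -size_poly_gt0 szP size_poly_gt0.
have [szP1|szP1] := leqP (size P) 1.
  have /size_poly1P[d d0 ->] : size P == 1%N.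
    by rewrite eqn_leq szP1 size_poly_gt0.
  by apply: factoredW (factored_polyC d0); apply: const_prime_elt.
have [[a [D [Q [a0 e /andP[szD szQ]]]]]|nirr] := pselect (exists a D Q,
  [/\ a != 0, a%:P * P = D * Q & (size D < size P)%N && (size Q < size P)%N]).
  have [D' [Q' [eP' szD' szQ']]] := factored_split a0 e.
  have : P != 0 by []; rewrite {1}eP' mulf_eq0 negb_or => /andP[D'0 Q'0].
  by rewrite eP'; apply: factoredM; apply: IH => //;
     rewrite ?szD' ?szQ' -ltnS; apply: leq_trans szf; rewrite -szP ltnS.
rewrite -[P]mulr1; apply: factored_mul; last exact/factored_unit/unitr1.
apply: primitive_irreducible_prime => // a D Q a0 e.
by apply/negP => sz; apply: nirr; exists a, D, Q.
Qed.

End FactorialPoly.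

(** * Multivariate polynomials *)

Lemma factorial_iso (R S : idomainType) (f : {rmorphism R -> S}) :
  bijective f -> factorial_ring S -> factorial_ring R.
Proof.
case=> g fK gK factS.
have gM x y : g (x * y) = g x * g y.
  by apply: (can_inj fK); rewrite rmorphM !gK.
have dvdf a b : dvdr (f a) (f b) -> dvdr a b.
  by case=> c e; exists (g c); rewrite -[b]fK e gM fK.
have unitf a : f a \is a GRing.unit -> a \is a GRing.unit.
  case/unitrPr=> c e; apply/unitrPr; exists (g c).
  by apply: (can_inj fK); rewrite rmorphM gK e rmorph1.
have primeg q : prime_elt q -> prime_elt (g q).
  case=> q0 nuq qp; split=> [||a b [c e]].
  - by apply: contraNneq q0 => e; rewrite -[q]gK e rmorph0.
  - by apply: contra nuq => /(rmorph_unit f); rewrite gK.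
  have : dvdr q (f a * f b) by exists (f c); rewrite -rmorphM e rmorphM gK.
  by case/qp=> h; [left|right]; apply: dvdf; rewrite gK.
have fact b : factored (@prime_elt S) b ->
    forall a, f a = b -> factored (@prime_elt R) a.
  elim=> [u Uu|q c qp _ IH] a e.
    by apply/factored_unit/unitf; rewrite e.
  rewrite -[a]fK e gM; apply: factored_mul; first exact: primeg.
  by apply: IH; rewrite gK.
move=> a a0; apply: (fact (f a)) => //; apply: factS.
apply: contraNneq a0 => e.
by rewrite -(inj_eq (can_inj fK)) e rmorph0.
Qed.

Section MuniIso.
Variables (n : nat) (R : idomainType).

(** Inverse of [muni], which singles out the last variable; the isomorphism carries factoriality
    from [n] to [n.+1] variables. *)
Definition muni_inv (q : {poly {mpoly R[n]}}) : {mpoly R[n.+1]} :=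
  (map_poly (@mwiden n R) q).['X_ord_max].

Lemma muni_invD : {morph muni_inv : p q / p + q}.
Proof. by move=> p q; rewrite /muni_inv rmorphD hornerD. Qed.

Lemma muniX_max : muni ('X_ord_max : {mpoly R[n.+1]}) = 'X.
Proof.
rewrite muniE msuppX big_seq1 mcoeffX eqxx scale1r mnmE eqxx expr1.
rewrite (_ : [multinom _ | i < n] = 0%MM) ?mpolyX0 ?scale1r //.
by apply/mnmP => i; rewrite !mnmE -val_eqE /= gtn_eqF.
Qed.

Lemma muni_mwiden (p : {mpoly R[n]}) : muni (mwiden p) = p%:P.
Proof.
elim/mpolyind: p => [|c m p _ _ IH]; first by rewrite !raddf0.
rewrite mwidenD mwidenZ mwidenX muniD muniZ IH polyCD; congr (_ + _).
rewrite muniE msuppX big_seq1 mcoeffX eqxx scale1r mnmwiden_ordmax expr0.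
rewrite -!mul_polyC mulr1 -polyCM mul_mpolyC; congr (_ *: 'X_[_])%:P.
by apply/mnmP => i; rewrite mnmE mnmwiden_widen.
Qed.

Lemma muniK : cancel (@muni n R) muni_inv.
Proof.
elim/mpolyind=> [|c m p _ _ IH].
  by rewrite raddf0 /muni_inv rmorph0 horner0.
rewrite muniD muni_invD [X in _ + X]IH; congr (_ + _).
rewrite muniZ muniE msuppX big_seq1 mcoeffX eqxx scale1r /muni_inv.
rewrite !map_polyZ !hornerZ map_polyXn hornerXn /= mwidenC mwidenX mul_mpolyC.
congr (_ *: _); rewrite mpolyXn -mpolyXD; congr 'X_[_].
apply/mnmP => i; rewrite mnmDE mulmnE mnm1E.
have [->|ni] := eqVneq i ord_max.
  by rewrite mnmwiden_ordmax mul1n.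
have lt_in : (i < n)%N.
  by move: ni; rewrite -val_eqE /= => ni; rewrite ltn_neqAle ni -ltnS ltn_ord.
have -> : i = widen_ord (leqnSn n) (Ordinal lt_in) by apply: val_inj.
by rewrite mnmwiden_widen mnmE mul0n addn0.
Qed.

Lemma muni_invK : cancel muni_inv (@muni n R).
Proof.
elim/poly_ind=> [|q c IH].
  by rewrite /muni_inv rmorph0 horner0 raddf0.
rewrite /muni_inv rmorphD rmorphM /= map_polyX map_polyC hornerMXaddC.
by rewrite muniD muniM IH muniX_max muni_mwiden.
Qed.

End MuniIso.

Lemma factorial_mpoly (k : fieldType) n : factorial_ring {mpoly k[n]}.
Proof.
elim: n => [|n IH].
  move=> a a0; apply: factored_unit.
  have e : a = (a@_0)%:MP.
    by apply/mpolyP => m; rewrite mcoeffC (_ : m = 0%MM) ?eqxx ?mulr1 //; apply/mnmP; case.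
  rewrite e in a0 *; rewrite mpolyC_eq0 in a0.
  by apply/unitrPr; exists ((a@_0)^-1)%:MP; rewrite -mpolyCM divff.
apply: (@factorial_iso _ _ (@muni n k)); last exact: factorial_poly.
by exists (@muni_inv n k); [apply: muniK | apply: muni_invK].
Qed.

Lemma mpoly_unitP (k : fieldType) n (c : {mpoly k[n]}) :
  reflect (msize c = 1%N) (c \is a GRing.unit).
Proof.
apply: (iffP idP) => [/unitrPr[d e]|/eqP/msize_poly1P[a a0 ->]]; last first.
  by apply/unitrPr; exists a^-1%:MP; rewrite -mpolyCM divff.
have c0 : c != 0 by apply: contraTneq isT => c0; move/eqP: e; rewrite c0 mul0r eq_sym oner_eq0.
have d0 : d != 0 by apply: contraTneq isT => d0; move/eqP: e; rewrite d0 mulr0 eq_sym oner_eq0.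
have := msizeM c0 d0; rewrite e msize1 (mpolySpred _ c0) (mpolySpred _ d0).
by rewrite addnS addSn /= => -[] /esym/eqP; rewrite addn_eq0 => /andP[/eqP-> _].
Qed.

(** No prime factor of [f i0] divides every [f i], so [f i0] divides [B i0]; the quotient is the
    multiplier for all indices. *)
Lemma gcd_is_one_dvdr (k : fieldType) n N (f B : 'I_N -> {mpoly k[n]}) :
  gcd_is_one f -> (exists i, f i != 0) ->
  (forall i i', f i * B i' = f i' * B i) -> exists g, forall i, B i = g * f i.
Proof.
move=> f1 [i0 fi0] e.
have [||g eg] := @factored_dvdr _ _ _ _ f B (B i0)
  (fun q qp => qp) (factorial_mpoly fi0).
- move=> q [_ nu _] dv; case/negP: nu; apply: f1 => i.
  by have [c ->] := dv i; exists c.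
- by move=> i; rewrite e.
exists g => i; apply: (mulfI fi0).
by rewrite e eg [RHS]mulrC mulrA [f i * g]mulrC.
Qed.

(** Dividing out a non-unit common divisor lowers the degree of the non-zero entry [A i0], so the
    process stops. *)
Lemma gcd_extract (k : fieldType) n N (A : 'I_N -> {mpoly k[n]}) :
  (exists i, A i != 0) ->
  exists c f, gcd_is_one f /\ forall i, A i = c * f i.
Proof.
case=> i0; have [s] := ubnP (msize (A i0)); elim: s A => // s IH A szA Ai0.
have [A1|nA1] := pselect (gcd_is_one A).
  by exists 1, A; split=> // i; rewrite mul1r.
have [c dv nuc] : exists2 c, forall i, exists q, A i = q * c & c \isn't a GRing.unit.
  apply: contrapT => nex; apply: nA1 => c dv; apply/negPn/negP => nu.
  by apply: nex; exists c.
have [q eq] := choice dv.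
have : A i0 != 0 by []; rewrite {1}eq mulf_eq0 negb_or => /andP[q0 c0].
have [||d [f [f1 ef]]] := IH q.
- move: szA; rewrite eq msizeM // (mpolySpred _ q0).
  have : msize c != 1%N by apply: contra nuc => /eqP/mpoly_unitP.
  rewrite (mpolySpred _ c0); case: (msize c).-1 => // t _.
  by rewrite !addSn !addnS /= !ltnS; apply: leq_ltn_trans; rewrite leq_addr.
- by [].
by exists (c * d), f; split=> // i; rewrite eq ef mulrC mulrA.
Qed.

(** * Divisors of homogeneous polynomials *)

Section HomogeneousDivisors.
Variables (k : fieldType) (n : nat).
Implicit Types p q : {mpoly k[n]}.

Lemma mcoeff_mlastM p q : (p * q)@_(mlast p + mlast q) = p@_(mlast p) * q@_(mlast q).
Proof.
set m := (_ + _)%MM.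
have lt1 : (mdeg (mlast p) < (mdeg m).+1)%N by rewrite ltnS mdegD leq_addr.
have lt2 : (mdeg (mlast q) < (mdeg m).+1)%N by rewrite ltnS mdegD leq_addl.
rewrite mcoeffM (bigD1 (BMultinom lt1, BMultinom lt2)) //= big1 ?addr0 //.
case=> [[m1 l1] [m2 l2]] /= /andP[/eqP em ne].
have [->|n1] := eqVneq p@_m1 0; first by rewrite mul0r.
have [->|n2] := eqVneq q@_m2 0; first by rewrite mulr0.
rewrite -mcoeff_msupp in n1; rewrite -mcoeff_msupp in n2.
have le1 := mlast_lemc n1; have le2 := mlast_lemc n2.
case/negP: ne; have [e1|ne1] := eqVneq m1 (mlast p).
  have e2 : m2 = mlast q by move: em; rewrite /m e1 => /addmI.
  by rewrite xpair_eqE -!val_eqE /= e1 e2 !eqxx.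
have lt : (mlast p < m1)%O by rewrite Order.POrderTheory.lt_neqAle eq_sym ne1.
by have := ltmc_le_add lt le2; rewrite -em Order.POrderTheory.ltxx.
Qed.

(** The extreme monomials of [p * q] are the products of those of [p] and [q]. Both have degree [d],
    so the lowest and the highest degree in [p] coincide. *)
Lemma dhomog_dvdl p q d : p * q != 0 -> p * q \is d.-homog ->
  exists2 e, (e <= d)%N & p \is e.-homog.
Proof.
move=> pq0 hpq; have : p * q != 0 by []; rewrite mulf_eq0 negb_or => /andP[p0 q0].
have sp := mlast_supp p0; have sq := mlast_supp q0.
have dlast : (mdeg (mlast p) + mdeg (mlast q) = d)%N.
  rewrite -mdegD; apply: (dhomog_mf hpq).
  by rewrite mcoeff_msupp mcoeff_mlastM mulf_neq0 // -mcoeff_msupp.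
have dlead : (mdeg (mlead p) + mdeg (mlead q) = d)%N.
  by rewrite -mdegD -mleadM //; apply: (dhomog_mf hpq); apply: mlead_supp.
have lp := lemc_mdeg (mlast_lemc (mlead_supp p0)).
have lq := lemc_mdeg (mlast_lemc (mlead_supp q0)).
have e : mdeg (mlead p) = mdeg (mlast p).
  apply/eqP; rewrite eqn_leq lp andbT -(leq_add2r (mdeg (mlead q))).
  by rewrite dlead -dlast leq_add2l.
exists (mdeg (mlead p)); first by rewrite -dlead leq_addr.
apply/dhomogP => m mp; apply/eqP; rewrite eqn_leq {2}e.
by rewrite (lemc_mdeg (mlast_lemc mp)) (lemc_mdeg (msupp_le_mlead mp)).
Qed.

Lemma dhomog_family N (A f : 'I_N -> {mpoly k[n]}) c d :
  (exists i, A i != 0) -> (forall i, A i \is d.-homog) ->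
  (forall i, A i = c * f i) -> exists e, forall i, f i \is e.-homog.
Proof.
case=> i0 Ai0 hA e; have : c * f i0 != 0 by rewrite -e.
move=> cf0; have := hA i0; rewrite e => /(dhomog_dvdl cf0)[dc _ hc].
have c0 : c != 0 by move: cf0; rewrite mulf_eq0 negb_or => /andP[].
exists (d - dc)%N => i; have [->|fi0] := eqVneq (f i) 0; first exact: dhomog0.
have := hA i; rewrite e mulrC => hfc.
have fc0 : f i * c != 0 by rewrite mulf_neq0.
have [df ledf hf] := dhomog_dvdl fc0 hfc.
by rewrite (dhomog_uniq fc0 hfc (dhomogM hf hc)) addnK.
Qed.

End HomogeneousDivisors.

(** A root of [r - 1] is a point where [r] takes the value 1; it exists unless [r - 1] is a non-zero
    constant. *)
Lemma closed_field_nonroot (k : closedFieldType) (r : {poly k}) :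
  r != 0 -> exists t, r.[t] != 0.
Proof.
move=> r0; have [/size_poly1P[c c0 e]|/closed_rootP[t]] := boolP (size (r - 1) == 1%N).
  exists 0; move: r0; rewrite -[r](subrK 1) e -polyCD polyC_eq0.
  by rewrite hornerC.
by rewrite rootE !hornerE subr_eq0 => /eqP e; exists t; rewrite e oner_neq0.
Qed.

Lemma meval_mwiden (k : fieldType) n (r : {mpoly k[n]}) (v : 'I_n.+1 -> k) :
  (mwiden r).@[v] = r.@[fun i => v (widen_ord (leqnSn n) i)].
Proof.
elim/mpolyind: r => [|c m r _ _ IH]; first by rewrite !raddf0.
rewrite mwidenD !mevalD [X in _ + X]IH mwidenZ !mevalZ mwidenX !mevalX.
rewrite big_ord_recr /= mnmwiden_ordmax expr0 mulr1.
by congr (_ * _ + _); apply: eq_bigr => i _; rewrite mnmwiden_widen.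
Qed.

Lemma meval_muni_inv (k : fieldType) n (q : {poly {mpoly k[n]}})
    (v : 'I_n.+1 -> k) :
  (muni_inv q).@[v] =
  (map_poly (meval (fun i => v (widen_ord (leqnSn n) i))) q).[v ord_max].
Proof.
elim/poly_ind: q => [|q c IH].
  by rewrite /muni_inv !rmorph0 !horner0 raddf0.
rewrite /muni_inv !rmorphD !rmorphM /= !map_polyX !map_polyC !hornerMXaddC.
by rewrite mevalD mevalM [X in X * _]IH mevalXU /= meval_mwiden.
Qed.

(** Choose the first variables so that the leading coefficient in the last one survives, then the
    last variable by the univariate case. *)
Lemma mpoly_nonroot (k : closedFieldType) n (p : {mpoly k[n]}) :
  p != 0 -> exists v, p.@[v] != 0.
Proof.
elim: n p => [|n IH] p p0.
  exists (fun=> 0); apply: contraNneq p0 => e; apply/eqP.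
  have ep : p = (p@_0)%:MP.
    apply/mpolyP => m; rewrite mcoeffC (_ : m = 0%MM) ?eqxx ?mulr1 //.
    by apply/mnmP; case.
  by move: e; rewrite ep mevalC => ->; rewrite mpolyC0.
have q0 : muni p != 0.
  by apply: contraNneq p0 => e; rewrite -[p]muniK e /muni_inv rmorph0 horner0.
have [v v0] := IH (lead_coef (muni p)) ltac:(by rewrite lead_coef_eq0).
have /closed_field_nonroot[t t0] : map_poly (meval v) (muni p) != 0.
  apply: contraNneq v0 => /polyP/(_ (size (muni p)).-1).
  by rewrite coef_map coef0 lead_coefE /= => ->.
pose w (i : 'I_n.+1) := if insub (val i) is Some j then v j else t.
have wt : w ord_max = t by rewrite /w insubF //= ltnn.
have wv : (fun i => w (widen_ord (leqnSn n) i)) = v.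
  by apply/funext => i; rewrite /w /= valK.
by exists w; rewrite -[p]muniK meval_muni_inv wt wv.
Qed.

Lemma dhomog_bigprod (k : fieldType) n (I : Type) (r : seq I)
    (F : I -> {mpoly k[n]}) (d : I -> nat) :
  (forall i, F i \is (d i).-homog) ->
  \prod_(i <- r) F i \is (\sum_(i <- r) d i)%N.-homog.
Proof.
move=> hF; elim: r => [|i r IH]; first by rewrite !big_nil dhomog1.
by rewrite !big_cons; apply: dhomogM.
Qed.

Lemma dhomog_comp_linear (k : fieldType) n m d (f : {mpoly k[n]})
    (lq : n.-tuple {mpoly k[m]}) :
  f \is d.-homog -> (forall i, tnth lq i \is 1.-homog) -> f \mPo lq \is d.-homog.
Proof.
move=> hf hl; rewrite comp_mpolyEX big_seq; apply: rpred_sum => mo mof.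
apply: rpredZ; rewrite comp_mpolyX -(dhomog_mf hf mof) /= mdegE.
by apply: dhomog_bigprod => i; have := dhomogMn (mo i) (hl i); rewrite mul1n.
Qed.

(** * Zeros of polynomials in homogeneous coordinates *)

Section HomogeneousCoordinates.
Variables (k : closedFieldType) (E : vectType k).
Implicit Types (x y z : E) (c p : {mpoly k[\dim {:E}]}).

Lemma hcoord_sum x : x = \sum_i hcoord x i *: (vbasis {:E})`_i.
Proof. exact: coord_vbasis (memvf x). Qed.

Lemma hcoord_surj (v : 'I_(\dim {:E}) -> k) : exists x, hcoord x = v.
Proof.
exists (\sum_i v i *: (vbasis {:E})`_i); apply/funext => i.
by rewrite /hcoord coord_sum_free // (basis_free (vbasisP _)).
Qed.

Lemma hcoordD x y i : hcoord (x + y) i = hcoord x i + hcoord y i.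
Proof. by rewrite /hcoord linearD. Qed.

Lemma hcoordZ (a : k) x i : hcoord (a *: x) i = a * hcoord x i.
Proof. by rewrite /hcoord linearZ. Qed.

Lemma mpoly_eq0_punctured p : (0 < \dim {:E})%N ->
  (forall x, x != 0 -> p.@[hcoord x] = 0) -> p = 0.
Proof.
move=> E0 pz; pose i0 := Ordinal E0; apply/eqP; apply: contraT => p0.
(* The factor ['X_i0] vanishes at the origin, where nothing is known about [p]. *)
have /mpoly_nonroot[v] : p * 'X_i0 != 0.
  by rewrite mulf_neq0 // -msupp_eq0 msuppX.
have [x <-] := hcoord_surj v; rewrite mevalM mevalXU.
have [->|x0] := eqVneq x 0; last by rewrite pz // mul0r eqxx.
by rewrite /hcoord linear0 mulr0 eqxx.
Qed.

Definition line_poly c x y : {poly k} :=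
  mmap polyC (fun i => (hcoord x i)%:P + (hcoord y i)%:P * 'X) c.

Lemma horner_line_poly c x y t :
  (line_poly c x y).[t] = c.@[hcoord (x + t *: y)].
Proof.
rewrite /line_poly mevalE /mmap horner_sum; apply: eq_bigr => m _.
rewrite hornerM hornerC; congr (_ * _); rewrite /mmap1 horner_prod.
apply: eq_bigr => i _; rewrite horner_exp !hornerE hcoordD hcoordZ.
by rewrite [t * _]mulrC.
Qed.

Lemma nonvanishing_line c x y : (forall z, z != 0 -> c.@[hcoord z] != 0) ->
  x != 0 -> y \notin <[x]>%VS -> c.@[hcoord x] = c.@[hcoord y].
Proof.
move=> nv x0 nyx.
have nz t : x + t *: (y - x) != 0.
  apply: contraNneq nyx => e.
  have [t0|t0] := eqVneq t 0.
    by move: e x0; rewrite t0 scale0r addr0 => ->; rewrite eqxx.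
  apply/vlineP; exists (1 - t^-1); apply: (scalerI t0).
  rewrite scalerA mulrBr mulr1 divff // scalerBl scale1r.
  by move/eqP: e; rewrite scalerBr addrCA addr_eq0 opprB => /eqP.
have : size (line_poly c x (y - x)) == 1%N.
  apply: contraT => /closed_rootP[t]; rewrite rootE horner_line_poly => /eqP e.
  by have := nv _ (nz t); rewrite e eqxx.
case/size_poly1P=> a _ ea.
have e0 := horner_line_poly c x (y - x) 0; have e1 := horner_line_poly c x (y - x) 1.
by move: e0 e1; rewrite ea !hornerC scale0r addr0 scale1r addrC subrK => <- <-.
Qed.

(* On an affine line avoiding 0, [c] restricts to a univariate polynomial     *)
(* without roots, that is a constant; such lines connect all non-zero points. *)
Lemma nonvanishing_unit c : (1 < \dim {:E})%N ->
  (forall x, x != 0 -> c.@[hcoord x] != 0) -> c \is a GRing.unit.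
Proof.
move=> E1 nv.
have out x : exists y, y \notin <[x]>%VS.
  apply: contrapT => nex; have : ({:E} <= <[x]>)%VS.
    by apply/subvP => y _; apply: contraT => ny; case: nex; exists y.
  move/dimvS; rewrite dim_vline => /(leq_trans E1).
  by case: (x != 0).
have cst x y : x != 0 -> y != 0 -> c.@[hcoord x] = c.@[hcoord y].
  move=> x0 y0; have [yx|] := boolP (y \in <[x]>%VS); last exact: nonvanishing_line.
  (* The line through collinear [x] and [y] may pass through 0, so they are compared via a vector
     [z] off their span. *)
  have [z nz] := out x; rewrite (nonvanishing_line nv x0 nz).
  apply/esym/nonvanishing_line => //; apply: contra nz => zy.
  by apply: subvP zy; rewrite -memvE.
have [y ny] := out 0; have y0 : y != 0.
  by apply: contraNneq ny => ->; rewrite mem0v.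
have e : c = (c.@[hcoord y])%:MP.
  apply/eqP; rewrite -subr_eq0; apply/eqP; apply: mpoly_eq0_punctured.
    exact: ltnW.
  by move=> x x0; rewrite mevalB mevalC (cst x y) // subrr.
by apply/mpoly_unitP; rewrite e msizeC nv.
Qed.

End HomogeneousCoordinates.

(** * Degree of a morphism of projective spaces *)

Section MorphismDegree.
Variables (k : closedFieldType) (E F : vectType k).
Implicit Types (f : 'I_(\dim {:F}) -> {mpoly k[\dim {:E}]}) (x : E).

Definition heval f x : F := \sum_i (f i).@[hcoord x] *: (vbasis {:F})`_i.

Lemma coord_heval f x i : coord (vbasis {:F}) i (heval f x) = (f i).@[hcoord x].
Proof. by rewrite coord_sum_free // (basis_free (vbasisP _)). Qed.

Lemma heval_neq0 f x : heval f x != 0 -> exists i, f i != 0.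
Proof.
move=> fx0; apply: contrapT => nex; case/eqP: fx0.
rewrite /heval big1 // => i _; have [->|fi] := eqVneq (f i) 0.
  by rewrite meval0 scale0r.
by case: nex; exists i.
Qed.

(** The 2 by 2 minors of the two families vanish at every non-zero point, hence as polynomials.
    Using a common [w] lets either value be zero. *)
Lemma heval_proportional f f' : (0 < \dim {:E})%N ->
  (forall x, x != 0 -> exists w a a', heval f x = a *: w /\ heval f' x = a' *: w) ->
  forall i i', f i * f' i' = f i' * f' i.
Proof.
move=> E0 prop i i'; apply/eqP; rewrite -subr_eq0; apply/eqP.
apply: (mpoly_eq0_punctured E0) => x x0; have [w [a [a' [ef ef']]]] := prop x x0.
rewrite mevalB !mevalM -!coord_heval ef ef' !linearZ /=.
set u := coord _ i w; set u' := coord _ i' w.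
by apply/eqP; rewrite subr_eq0 mulrACA [u * u']mulrC mulrACA.
Qed.

Lemma nonzero_vector : (0 < \dim {:E})%N -> exists x : E, x != 0.
Proof.
move=> E0; exists (vpick {:E}); rewrite vpick0.
by apply: contraTneq E0 => ->; rewrite dimv0.
Qed.

(** Pointwise proportionality and gcd 1 give [f' = g f]; then [g] divides every component of [f'],
    so it is a non-zero constant. *)
Lemma is_morphism_degree_uniq (U : E -> bool) (phi : E -> {vspace F}) d d' :
  (0 < \dim {:E})%N -> (forall x, x != 0 -> U x) ->
  (forall x, x != 0 -> phi x != 0%VS) ->
  is_morphism_degree U phi d -> is_morphism_degree U phi d' -> d = d'.
Proof.
move=> E0 UT phi0 [f [hf f1 ef]] [f' [hf' f1' ef']].
have nz x : x != 0 -> heval f' x != 0.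
  move=> x0; apply: contraNneq (phi0 x x0) => e.
  by rewrite ef' ?UT // -/(heval f' x) e.
have fp := @heval_proportional f f' E0.
have [x x0] := nonzero_vector E0.
have [||g eg] := gcd_is_one_dvdr (B := f') f1.
- apply: (@heval_neq0 _ x); apply: contraNneq (phi0 x x0) => e.
  by rewrite ef ?UT // -/(heval f x) e.
- apply: fp => y y0; exists (heval f y).
  have : heval f' y \in <[heval f y]>%VS.
    by rewrite /heval -ef ?UT // ef' ?UT // memv_line.
  by case/vlineP=> a ea; exists 1, a; rewrite scale1r.
have Ug : g \is a GRing.unit.
  by apply: f1' => i; exists (f i); rewrite eg mulrC.
have [i f'i] := heval_neq0 (nz x x0).
have := Ug; move/mpoly_unitP/eqP/msize_poly1P=> [c c0 egc].
apply: (dhomog_uniq f'i _ (hf' i)).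
by rewrite eg egc mul_mpolyC; apply: rpredZ.
Qed.

Lemma morphism_degreeE (U : E -> bool) (phi : E -> {vspace F}) d :
  (0 < \dim {:E})%N -> (forall x, x != 0 -> U x) ->
  (forall x, x != 0 -> phi x != 0%VS) ->
  is_morphism_degree U phi d -> morphism_degree U phi = d.
Proof.
move=> E0 UT phi0 md; rewrite /morphism_degree.
case: xgetP => [e -> md'|/(_ d)]; last by [].
exact: is_morphism_degree_uniq md' md.
Qed.

(* A common divisor of the restrictions has no zero outside 0: such a zero    *)
(* would be a common zero of a family defining a morphism on all of P(E).     *)
Lemma is_morphism_degree_restrict (E' : vectType k) (l : {linear E' -> E})
    (U : E -> bool) (phi : E -> {vspace F})
    (U' : E' -> bool) (phi' : E' -> {vspace F}) d :
  injective l -> (1 < \dim {:E'})%N -> (forall x, x != 0 -> U x) ->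
  (forall x, x != 0 -> phi x != 0%VS) ->
  (forall y, y != 0 -> phi' y = phi (l y)) ->
  is_morphism_degree U phi d -> is_morphism_degree U' phi' d.
Proof.
move=> linj E1 UT phi0 ephi [f [hf f1 ef]].
(* The linear forms giving the coordinates of [l x]; substituting them pulls [f] back along [l]. *)
pose lq := [tuple \sum_(j < \dim {:E'})
  hcoord (l (vbasis {:E'})`_j) i *: ('X_j : {mpoly k[\dim {:E'}]}) | i < \dim {:E}].
have l0 (x : E') : x != 0 -> l x != 0.
  by apply: contra => /eqP e; apply/eqP; apply: linj; rewrite e linear0.
have ev i (x : E') : (f i \mPo lq).@[hcoord x] = (f i).@[hcoord (l x)].
  rewrite comp_mpoly_meval; apply: meval_eq => t.
  rewrite tnth_mktuple raddf_sum /= [in RHS](hcoord_sum x) linear_sum /=.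
  rewrite /hcoord linear_sum /=; apply: eq_bigr => j _.
  by rewrite mevalZ mevalXU !linearZ /= mulrC.
exists (fun i => f i \mPo lq); split.
- move=> i; apply: dhomog_comp_linear => // t; rewrite tnth_mktuple.
  apply: rpred_sum => j _; apply: rpredZ.
  by rewrite dhomogX /= mdeg1.
- move=> c dv; apply: nonvanishing_unit => // x x0.
  apply: contraNneq (phi0 _ (l0 x x0)) => cx; rewrite ef ?UT ?l0 // big1 // => i _.
  by have [q eq] := dv i; rewrite -ev eq mevalM cx mulr0 scale0r.
- move=> x x0 _; rewrite ephi // ef ?UT ?l0 //.
  by congr <[_]>%VS; apply: eq_bigr => i _; rewrite ev.
Qed.

(* Dividing one of the proportional families by its gcd gives [f]; every      *)
(* other family is then a polynomial multiple of [f], so [f] vanishes nowhere.*)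
Lemma is_morphism_degree_exists (U : E -> bool) (phi : E -> {vspace F})
    (T : Type) (A : T -> 'I_(\dim {:F}) -> {mpoly k[\dim {:E}]}) D :
  (0 < \dim {:E})%N -> (forall t i, A t i \is D.-homog) ->
  (forall x, x != 0 -> exists2 w, phi x = <[w]>%VS &
     (forall t, exists a, heval (A t) x = a *: w) /\
     exists t, heval (A t) x != 0) ->
  exists d, is_morphism_degree U phi d.
Proof.
move=> E0 hA lA; have [x0 x00] := nonzero_vector E0.
have [w0 _ [_ [t0 At0]]] := lA x0 x00.
have At0n := heval_neq0 At0.
have [c [f [f1 ef]]] := gcd_extract At0n.
have [d hf] := dhomog_family At0n (hA t0) ef.
have c0 : c != 0.
  by have [i] := At0n; rewrite ef mulf_eq0 negb_or => /andP[].
have fn : exists i, f i != 0.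
  by have [i] := At0n; rewrite ef mulf_eq0 negb_or => /andP[_ fi]; exists i.
have multA t : exists g, forall i, A t i = g * f i.
  apply: (gcd_is_one_dvdr f1 fn) => i i'; apply: (mulfI c0).
  rewrite !mulrA -!ef; apply: heval_proportional => // x xn.
  have [w _ [prop _]] := lA x xn; have [a ea] := prop t0; have [a' ea'] := prop t.
  by exists w, a, a'.
exists d, f; split=> // x xn _; have [w ew [prop [t Atx]]] := lA x xn.
have [g eg] := multA t; have [a ea] := prop t.
have eAt : heval (A t) x = g.@[hcoord x] *: heval f x.
  rewrite /heval scaler_sumr; apply: eq_bigr => i _.
  by rewrite eg mevalM scalerA.
have a0 : a != 0 by apply: contraNneq Atx => e; rewrite ea e scale0r.
have gx0 : g.@[hcoord x] != 0 by apply: contraNneq Atx => e; rewrite eAt e scale0r.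
rewrite ew -/(heval f x); apply/eqP; rewrite eqEsubv -!memvE.
apply/andP; split; apply/vlineP.
  by exists (a^-1 * g.@[hcoord x]); rewrite -scalerA -eAt ea scalerA mulVf ?scale1r.
by exists ((g.@[hcoord x])^-1 * a); rewrite -scalerA -ea eAt scalerA mulVf ?scale1r.
Qed.

End MorphismDegree.

(** * Minors and Pluecker coordinates *)

(** The map [s] enumerates the image of [t] in order. It converts an unordered choice of independent
    columns into an index of a Pluecker coordinate. *)
Lemma increasing_factor d m (t : 'I_d -> 'I_m) : injective t ->
  exists2 s : 'I_d -> 'I_m, {homo s : i j / (i < j)%N} &
    exists u : 'I_d -> 'I_d, forall i, t i = s (u i).
Proof.
case: d t => [|d] t tinj.
  by exists t; [case | exists id].
pose A := [set t i | i in 'I_d.+1]; pose x0 := t ord0.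
have szA : size (enum A) = d.+1 by rewrite -cardE card_imset // card_ord.
have srt : sorted ltn (map val (enum A)).
  rewrite (_ : map val _ = filter (fun i => [exists j in A, val j == i])
      (map val (enum 'I_m))); last first.
    rewrite filter_map enumT /enum_mem; congr (map _ _); apply: eq_filter => i /=.
    apply/idP/existsP => [iA|[j /andP[jA /eqP/val_inj <-]]] //.
    by exists i; rewrite iA eqxx.
  by rewrite val_enum_ord; apply: (sorted_filter ltn_trans); apply: iota_ltn_sorted.
exists (fun i => nth x0 (enum A) i) => [i j ij|].
  rewrite -!(nth_map x0 0%N val) ?szA ?ltn_ord //.
  by apply: (sorted_ltn_nth ltn_trans) => //; rewrite inE size_map szA.
have tA i : (index (t i) (enum A) < d.+1)%N.
  by rewrite -szA index_mem mem_enum imset_f.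
exists (fun i => Ordinal (tA i)) => i /=.
by rewrite nth_index // mem_enum imset_f.
Qed.

Section PluckerMinors.
Variables (k : fieldType) (M : vectType k).
Local Notation e := (vbasis {:M}).

Lemma coord_vbasis_vbasis (W : {vspace M}) (i l : 'I_(\dim W)) :
  coord (vbasis W) l (vbasis W)`_i = (l == i)%:R.
Proof. by rewrite coord_free ?(basis_free (vbasisP _)) // eq_sym. Qed.

Lemma coord_lin (W : {vspace M}) (X : 'End(M)) u l :
  coord (vbasis W) l (X u) = \sum_a coord e a u * coord (vbasis W) l (X e`_a).
Proof.
rewrite {1}(coord_vbasis (memvf u)) !linear_sum /=.
by apply: eq_bigr => a _; rewrite !linearZ.
Qed.

(** The coordinate matrix of a basis has independent rows, so one of its maximal minors is
    non-zero. *)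
Lemma wedge_neq0 (W : {vspace M}) : wedge (\dim W) (vbasis W) != 0.
Proof.
pose Wm := \matrix_(i < \dim W, b < \dim {:M}) coord e b (vbasis W)`_i.
have Wfull : row_full Wm^T.
  rewrite /row_full mxrank_tr -/(row_free Wm).
  apply/row_freeP; exists (\matrix_(b, l) coord (vbasis W) l e`_b).
  apply/matrixP => i l; rewrite !mxE eq_sym -coord_vbasis_vbasis.
  have := coord_lin \1%VF (vbasis W)`_i l; rewrite id_lfunE => ->.
  by apply: eq_bigr => b _; rewrite !mxE id_lfunE.
have [s s_incr [u tsu]] := increasing_factor (@fullrankfun_inj _ _ _ _ Wfull).
have s_idx : [forall i : 'I_(\dim W), forall j : 'I_(\dim W),
    (i < j)%N ==> ([ffun i => s i] i < [ffun i => s i] j)%N].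
  by apply/forallP => i; apply/forallP => j; apply/implyP; rewrite !ffunE; apply: s_incr.
pose idx : incr_idx M (\dim W) := exist _ [ffun i => s i] s_idx.
have sub : (rowsub (fullrankfun Wfull) Wm^T <= rowsub s Wm^T)%MS.
  by apply: (submx_rowsub u) => i; rewrite /= tsu.
have : rowsub s Wm^T \in unitmx.
  rewrite -row_full_unit -col_leq_rank; apply: leq_trans (mxrankS sub).
  by rewrite mxrank_fullrowsub.
rewrite unitmxE unitfE -det_tr; apply: contraNneq => /ffunP/(_ idx).
rewrite !ffunE /= => det0; rewrite -[X in _ == X]det0; apply/eqP; congr (\det _).
by apply/matrixP => i j; rewrite !mxE ffunE.
Qed.

(** The matrix of [X] factors through the image as [C] times the coordinate matrix of a basis of it.
    A minor is therefore a row minor [c t] of [C] times a Pluecker coordinate, and [C] has full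
    rank. *)
Lemma minors_wedge (d : nat) (X : 'End(M)) : \dim (limg X) = d ->
  exists2 c : ('I_d -> 'I_(\dim {:M})) -> k, exists t, c t != 0 &
  forall t (s : incr_idx M d), \det (\matrix_(i < d, j < d) mxof e e X (t i) (val s j)) =
    c t * wedge d (vbasis (limg X)) s.
Proof.
move=> <-; set W := limg X.
pose C := \matrix_(a < \dim {:M}, i < \dim W) coord (vbasis W) i (X e`_a).
have Cfull : row_full C.
  apply/row_fullP; exists (\matrix_(i, a) coord e a ((X^-1)%VF (vbasis W)`_i)).
  apply/matrixP => i l; rewrite !mxE eq_sym -coord_vbasis_vbasis.
  have iW : (vbasis W)`_i \in W by apply/vbasis_mem/mem_nth; rewrite size_tuple.
  have := coord_lin X ((X^-1)%VF (vbasis W)`_i) l; rewrite limg_lfunVK // => ->.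
  by apply: eq_bigr => a _; rewrite !mxE.
exists (fun t => \det (rowsub t C)) => [|t s].
  exists (fullrankfun Cfull); rewrite -unitfE -unitmxE.
  exact: fullrowsub_unit.
rewrite ffunE -det_mulmx; congr (\det _); apply/matrixP => i j; rewrite !mxE.
rewrite vecof_delta /= {1}(@coord_vbasis _ _ (X e`_(t i)) W) ?memv_img ?memvf //.
by rewrite linear_sum; apply: eq_bigr => l _; rewrite linearZ !mxE.
Qed.

End PluckerMinors.

Lemma dhomog_det (k : fieldType) n d D (B : 'M[{mpoly k[n]}]_d) :
  (forall i j, B i j \is D.-homog) -> \det B \is (D * d).-homog.
Proof.
move=> hB; rewrite /determinant; apply: rpred_sum => s _.
have := dhomog_bigprod (index_enum 'I_d) (fun i => hB i (s i)).
rewrite sum_nat_const card_ord mulnC mulr_sign => hp.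
by case: ifP; rewrite ?rpredN.
Qed.

Section ImageDegree.
Variables (k : closedFieldType) (E M : vectType k) (X : E -> 'End(M)).
Variables (d D : nat) (B : 'M[{mpoly k[\dim {:E}]}]_(\dim {:M})).
Hypothesis homogB : forall a b, B a b \is D.-homog.
Hypothesis evalB : forall x a b,
  (B a b).@[hcoord x] = mxof (vbasis {:M}) (vbasis {:M}) (X x) a b.
Hypothesis rankX : forall x, x != 0 -> \dim (limg (X x)) = d.

Lemma plucker_neq0 x : x != 0 -> plucker d (limg (X x)) != 0%VS.
Proof.
move/rankX=> <-; apply: contra (wedge_neq0 (limg (X x))).
by rewrite -memv0 => /eqP <-; rewrite memv_line.
Qed.

Lemma plucker_degree_exists (U : E -> bool) : (0 < \dim {:E})%N ->
  exists e, is_morphism_degree U (fun x => plucker d (limg (X x))) e.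
Proof.
move=> E0.
pose minor (t : 'I_d -> 'I_(\dim {:M})) (s : incr_idx M d) :=
  \det (\matrix_(i < d, j < d) B (t i) (val s j)).
(* Degrees are computed in the basis [vbasis] of [extpow M d], while minors are coordinates in the
   standard basis [delta]; [A] makes the change of basis. *)
pose delta (s : incr_idx M d) : extpow M d := [ffun s' => (s' == s)%:R].
pose A t l := \sum_s coord (vbasis {:extpow M d}) l (delta s) *: minor t s.
have hA t l : A t l \is (D * d).-homog.
  apply: rpred_sum => s _; apply: rpredZ; apply: dhomog_det => i j.
  by rewrite mxE.
have evm t s x : (minor t s).@[hcoord x] =
    \det (\matrix_(i < d, j < d) mxof (vbasis {:M}) (vbasis {:M}) (X x) (t i) (val s j)).
  rewrite -det_map_mx; congr (\det _).
  by apply/matrixP => i j; rewrite [LHS]mxE [in LHS]mxE [RHS]mxE; apply: evalB.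
have evA t x : heval (A t) x = [ffun s => (minor t s).@[hcoord x]].
  have -> : [ffun s => (minor t s).@[hcoord x]] =
      \sum_s (minor t s).@[hcoord x] *: delta s :> extpow M d.
    apply/ffunP => s; rewrite sum_ffunE ffunE (bigD1 s) //= !ffunE eqxx.
    rewrite big1 ?addr0 => [|s' ns]; first by rewrite /GRing.scale /= mulr1.
    by rewrite !ffunE eq_sym (negPf ns) scaler0.
  rewrite [RHS](coord_vbasis (memvf _)); apply: eq_bigr => l _; congr (_ *: _).
  rewrite linear_sum raddf_sum /=; apply: eq_bigr => s _.
  by rewrite mevalZ linearZ /= mulrC.
apply: (@is_morphism_degree_exists _ _ _ _ _ _ A _ E0 hA) => x x0.
exists (wedge d (vbasis (limg (X x)))) => //.
have [c [t ct0] ec] := minors_wedge (rankX x0).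
have ev t' : heval (A t') x = c t' *: wedge d (vbasis (limg (X x))).
  by rewrite evA; apply/ffunP => s; rewrite !ffunE evm ec ffunE.
split=> [t'|]; first by exists (c t').
exists t; rewrite ev scaler_eq0 negb_or ct0 /=.
by rewrite -(rankX x0) wedge_neq0.
Qed.

End ImageDegree.

(** * The j-degree of a module *)

HB.instance Definition _ (k : fieldType) (A : algType k) (M : fdmodule A)
  (a : A) := GRing.isLinear.Build k M M _ (fdm_act a) (fdm_actDr a).

Section Operators.
Variables (k : fieldType) (p : nat) (g : rLieType k p) (M : fdmodule (U0 g)).
Implicit Types (x y : g).

Lemma operatorE x m : operator M x m = fdm_act (U0_gen x) m.
Proof. by rewrite lfunE. Qed.

Lemma operator_linear : linear (operator M).
Proof.
move=> a x y; apply/lfunP => m.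
by rewrite add_lfunE scale_lfunE !operatorE linearP fdm_actDl.
Qed.
HB.instance Definition _ :=
  GRing.isLinear.Build k g 'End(M) _ (operator M) operator_linear.

Lemma op_rank0 j : (0 < j)%N -> op_rank M j 0 = 0%N.
Proof.
case: j => // j _; rewrite /op_rank /operator_pow iterS linear0 comp_lfun0l.
apply/eqP; rewrite dimv_eq0 -subv0; apply/subvP => _ /memv_imgP[u _ ->].
by rewrite lfunE /= mem0v.
Qed.

(** The maximum also ranges over 0, which constancy does not cover; its rank is 0 because [j] is
    positive. *)
Lemma generic_jrank_const j x : (0 < j)%N -> constant_jrank M j ->
  x \in nullcone g -> x != 0 -> generic_jrank M j = op_rank M j x.
Proof.
move=> j0 const xN x0; apply/eqP; rewrite eqn_leq; apply/andP; split.
  apply/bigmax_leqP => r /asboolP[y yN <-].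
  have [->|y0] := eqVneq y 0; first by rewrite op_rank0.
  by rewrite (const y x).
have lt : (op_rank M j x < (\dim {:M}).+1)%N by rewrite ltnS dimvS ?subvf.
by apply: (bigmax_sup (Ordinal lt)) => //; apply/asboolP; exists x.
Qed.

End Operators.

Section OperatorMatrix.
Variables (k : closedFieldType) (p : nat) (g : rLieType k p).
Variables (M : fdmodule (U0 g)) (V : {vspace g}).
Local Notation E := (subvs_of V).
Local Notation e := (vbasis {:M}).

Definition operator_mx : 'M[{mpoly k[\dim {:E}]}]_(\dim {:M}) :=
  \matrix_(a, b) \sum_(i < \dim {:E})
    mxof e e (operator M (vsval (vbasis {:E})`_i)) a b *: 'X_i.

(** The new factor stands on the right because [mxof] acts on row vectors and so reverses
    composition. *)
Definition operator_pow_mx j : 'M[{mpoly k[\dim {:E}]}]_(\dim {:M}) :=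
  iter j (fun B => B *m operator_mx) 1%:M.

Lemma dhomog_operator_pow_mx j a b : operator_pow_mx j a b \is j.-homog.
Proof.
elim: j a b => [|j IH] a b /=.
  by rewrite mxE; case: (a == b); rewrite ?dhomog1 ?dhomog0.
rewrite mxE; apply: rpred_sum => i _; rewrite -addn1; apply: dhomogM => //.
by rewrite mxE; apply: rpred_sum => l _; apply: rpredZ; rewrite dhomogX /= mdeg1.
Qed.

Lemma eval_operator_mx (x : E) :
  map_mx (meval (hcoord x)) operator_mx = mxof e e (operator M (vsval x)).
Proof.
apply/matrixP => a b; rewrite [in RHS](hcoord_sum x) !linear_sum /= summxE.
rewrite [LHS]mxE [X in meval _ X]mxE raddf_sum; apply: eq_bigr => i _ /=.
by rewrite mevalZ mevalXU mulrC linearZ /= linearZ [RHS]mxE.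
Qed.

Lemma eval_operator_pow_mx j (x : E) :
  map_mx (meval (hcoord x)) (operator_pow_mx j) =
  mxof e e (operator_pow M j (vsval x)).
Proof.
elim: j => [|j IH] /=; first by rewrite map_mx1 mxof1 ?(basis_free (vbasisP _)).
by rewrite map_mxM IH eval_operator_mx (mxof_comp e e (vbasisP _)).
Qed.

End OperatorMatrix.

Section JDegree.
Variables (k : closedFieldType) (p : nat) (g : rLieType k p).
Variables (M : fdmodule (U0 g)) (j r : nat).
Hypothesis V_subspace : nullcone_is_subspace g.
Hypothesis j_gt0 : (0 < j)%N.
Hypothesis M_const : constant_jrank M j.
Hypothesis rankE : generic_jrank M j = r.
Hypothesis V_gt0 : (0 < \dim (nullspace g))%N.
Local Notation E := (subvs_of (nullspace g)).

Lemma nullspaceE : nullspace g =i nullcone g.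
Proof. exact: (xgetPex (P := [set V | V =i nullcone g]%classic) 0%VS V_subspace). Qed.

Lemma dim_subvs : \dim {:E} = \dim (nullspace g).
Proof. by rewrite dimvf. Qed.

Lemma op_rank_nullspace (x : E) : x != 0 ->
  op_rank M j (vsval x) = r.
Proof.
move=> x0; rewrite -rankE (generic_jrank_const j_gt0 M_const (x := vsval x)) //.
by rewrite -nullspaceE subvsP.
Qed.

(** With the rank as a parameter [r], the maps of a module and of its restriction take values in the
    same exterior power. *)
Definition im_plucker (x : E) :=
  plucker r (limg (operator_pow M j (vsval x))).
Definition generic_locus (x : E) := op_rank M j (vsval x) == r.

Lemma generic_locusT x : x != 0 -> generic_locus x.
Proof. by move/op_rank_nullspace=> e; apply/eqP. Qed.

Lemma im_plucker_neq0 x : x != 0 -> im_plucker x != 0%VS.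
Proof.
by apply: (@plucker_neq0 _ _ _ (fun x => operator_pow M j (vsval x))) => y;
   apply: op_rank_nullspace.
Qed.

Lemma im_plucker_degree_exists :
  exists d, is_morphism_degree generic_locus im_plucker d.
Proof.
apply: (@plucker_degree_exists _ _ _ (fun x => operator_pow M j (vsval x)) _ j
  (operator_pow_mx M (nullspace g) j)).
- exact: dhomog_operator_pow_mx.
- by move=> x a b; rewrite -eval_operator_pow_mx mxE.
- exact: op_rank_nullspace.
- by rewrite dim_subvs.
Qed.

Lemma jdegreeE d : r != 0%N ->
  is_morphism_degree generic_locus im_plucker d -> jdegree j M = d.
Proof.
move=> r0 md; rewrite /jdegree rankE (negPf r0).
apply: morphism_degreeE md; first by rewrite dim_subvs.
  exact: generic_locusT.
exact: im_plucker_neq0.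
Qed.

End JDegree.

(** * Restriction to a $p$-subalgebra *)

Section Restriction.
Variables (k : fieldType) (p : nat) (g : rLieType k p) (h : psubalg g).
Variable M : fdmodule (U0 g).

Lemma nullcone_psub (x : psub_of h) :
  (x \in nullcone (psub_of h)) = (psub_val x \in nullcone g).
Proof. by rewrite !inE -(inj_eq (@psub_val_inj _ _ _ h)) linear0. Qed.

Lemma nullcone_psub_is_subspace :
  nullcone_is_subspace g -> nullcone_is_subspace (psub_of h).
Proof.
case=> V VE; exists (linfun (@psub_val _ _ _ h) @^-1: V)%VS => x.
by rewrite -memv_preim lfunE /= VE nullcone_psub.
Qed.

Lemma U0_incl_gen (x : psub_of h) : U0_incl (U0_gen x) = U0_gen (psub_val x).
Proof. exact: U0_inclE. Qed.

Lemma operator_restrict (x : psub_of h) :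
  operator (restrict h M) x = operator M (psub_val x).
Proof.
apply/lfunP => m; have := @operatorE _ _ _ M (psub_val x) m.
by rewrite -U0_incl_gen => e; rewrite operatorE; apply: esym e.
Qed.

Lemma operator_pow_restrict j (x : psub_of h) :
  operator_pow (restrict h M) j x = operator_pow M j (psub_val x).
Proof. by rewrite /operator_pow operator_restrict. Qed.

Lemma op_rank_restrict j (x : psub_of h) :
  op_rank (restrict h M) j x = op_rank M j (psub_val x).
Proof. by rewrite /op_rank operator_pow_restrict. Qed.

Lemma constant_jrank_restrict j :
  constant_jrank M j -> constant_jrank (restrict h M) j.
Proof.
have nz (x : psub_of h) : x != 0 -> psub_val x != 0.
  by rewrite -(inj_eq (@psub_val_inj _ _ _ h)) linear0.
move=> const x y; rewrite !nullcone_psub !op_rank_restrict => xN x0 yN y0.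
by apply: const => //; apply: nz.
Qed.

End Restriction.

Theorem theorem4p1p2 (k : closedFieldType) (p : nat) (pchar_k : p \in [pchar k])
    (g : rLieType k p) (V_subspace : nullcone_is_subspace g)
    (h : psubalg g) (dimVh : (2 <= \dim (nullspace (psub_of h)))%N)
    (j : nat) (j_range : (1 <= j <= p.-1)%N)
    (M : fdmodule (U0 g)) (M_const : constant_jrank M j) :
  jdegree j M = jdegree j (restrict h M).
Proof.
have j0 : (0 < j)%N by case/andP: j_range.
have Vh := nullcone_psub_is_subspace h V_subspace.
have constN := constant_jrank_restrict (h := h) M_const.
have inV (x : subvs_of (nullspace (psub_of h))) :
    psub_val (vsval x) \in nullspace g.
  by rewrite nullspaceE // -nullcone_psub -nullspaceE // subvsP.
(* The inclusion of $V(\mathfrak{h})$ into $V(\mathfrak{g})$; by [inV] the projection [vsproj]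
   changes no vector here. *)
pose l : {linear subvs_of (nullspace (psub_of h)) -> subvs_of (nullspace g)} :=
  vsproj (nullspace g) \o (@psub_val _ _ _ h \o vsval).
have lE x : vsval (l x) = psub_val (vsval x) by rewrite /= vsprojK.
have linj : injective l.
  by move=> x y /(congr1 vsval); rewrite !lE => /psub_val_inj/val_inj.
have dimE1 : (1 < \dim {:subvs_of (nullspace (psub_of h))})%N by rewrite dim_subvs.
have [x x0] := nonzero_vector (ltnW dimE1).
have lx0 : l x != 0 by rewrite -(linear0 l) (inj_eq linj).
have Vg0 : (0 < \dim (nullspace g))%N.
  rewrite lt0n dimv_eq0; apply: contraNneq lx0 => e.
  by rewrite -(inj_eq val_inj) /= -memv0 -e lE.
(* Both generic ranks are attained at the non-zero vector [x] of $V(\mathfrak{h})$. *)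
have rkE : generic_jrank (restrict h M) j = generic_jrank M j.
  rewrite -(op_rank_nullspace Vh j0 constN erefl x0) op_rank_restrict -lE.
  exact: op_rank_nullspace.
have [r0|r0] := eqVneq (generic_jrank M j) 0%N.
  by rewrite /jdegree rkE r0.
have [d md] := im_plucker_degree_exists V_subspace j0 M_const erefl Vg0.
rewrite (jdegreeE V_subspace j0 M_const erefl Vg0 r0 md); apply/esym.
apply: (jdegreeE Vh j0 constN rkE (ltnW dimVh) r0).
(* The restriction has the same underlying space as [M]; the type of [phi] makes the two target
   spaces syntactically equal. *)
pose phi (y : subvs_of (nullspace (psub_of h))) :
  {vspace extpow M (generic_jrank M j)} := im_plucker (restrict h M) j _ y.
suff : is_morphism_degree (generic_locus (restrict h M) j (generic_jrank M j)) phi d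
  by [].
apply: is_morphism_degree_restrict linj dimE1 _ _ _ md.
- by move=> y; apply: generic_locusT.
- by move=> y; apply: im_plucker_neq0.
by move=> y y0; rewrite /phi /im_plucker lE operator_pow_restrict.
Qed.
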